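(* Let $\gamma\in(0,1]$, $\mu\in\mathbb R$, $\sigma^2\in(0,\infty)$, $\lambda\in(0,\infty)$. Assume that a random variable $Z$ is representable in the form $$Z\stackrel{d}{=}\Big(\frac{\sigma}{\sqrt{\lambda}}\cdot X\sqrt{W_1}+\frac{\mu W_1}{\lambda}\Big)\cdot V_{\gamma},$$ where the random variable $X$ has the standard normal distribution, the random variable $W_1$ has the standard exponential distribution (so that $W_1/\lambda$ has the exponential distribution with parameter $\lambda$), $V_{\gamma}=2S_{\gamma,1}^{-1}$, where $S_{\gamma,1}$ is the random variable with the one-sided strictly stable density $g_{\gamma,1}(x)$, and moreover $X$, $W_1$ and $S_{\gamma,1}$ are independent. Then $Z\stackrel{d}{=}W_{a_1,a_2;\gamma}$, that is, $$\mathsf P(Z<x)=\mathsf E\,\Phi\bigg(\frac{\lambda x-\mu W_1V_{\gamma}}{\sigma\sqrt{\lambda W_1}\,V_{\gamma}}\bigg)=\mathsf P(W_{a_1,a_2;\gamma}<x)=\mathfrak W_I(x),\qquad x\in\mathbb R,$$ where $$a_1=\frac{1}{\sqrt{\mu^2+2\lambda\sigma^2}+\mu},\qquad a_2=\frac{1}{\sqrt{\mu^2+2\lambda\sigma^2}-\mu}.$$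
   Context: $\stackrel{d}{=}$ denotes coincidence of distributions; $\Phi$ is the standard normal distribution function. For $0<\alpha\le 2$ and $|\theta|\le\min\{1,\frac{2}{\alpha}-1\}$, $g_{\alpha,\theta}$ denotes the density of the strictly stable distribution with characteristic exponent $\alpha$ and parameter $\theta$, corresponding to the characteristic function $$\mathfrak f_{\alpha,\theta}(t)=\exp\big\{-|t|^{\alpha}\exp\{-\tfrac12 i\pi\theta\alpha\,\mathrm{sign}\,t\}\big\},\qquad t\in\mathbb R;$$ the one-sided strictly stable law is the case $\theta=1$. For finite positive numbers $a_1,a_2$ and $\gamma>0$, the random variable $W_{a_1,a_2;\gamma}$ has the asymmetric Weibull distribution of the first kind $\mathfrak W_I$ with parameters $a_1,a_2,\gamma$ if $$\mathfrak W_I(x)=\mathsf P(W_{a_1,a_2;\gamma}<x)=\begin{cases}\dfrac{a_1}{a_1+a_2}\,e^{-(a_2|x|)^\gamma}, & x\le 0,\\[2mm] 1-\dfrac{a_2}{a_1+a_2}\,e^{-(a_1x)^\gamma}, & x>0.\end{cases}$$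
   Formalization: The parameters are corrected to a_1 = λ/(√(μ²+2λσ²)+μ) and a_2 = λ/(√(μ²+2λσ²)−μ); the printed numerators 1 are right only for λ = 1 (e.g. γ=1, μ=0, σ=1, λ=2 gives Laplace rate 1, not 1/2). *)

(* Defs.v *)
(* MathComp / MathComp-Analysis. *)
From HB Require Import structures.
From mathcomp Require Import all_boot all_order all_algebra.
From mathcomp Require Import complex.
From mathcomp Require Import all_classical all_reals all_analysis.

Set Implicit Arguments.
Unset Strict Implicit.
Unset Printing Implicit Defensive.

Import Order.TTheory GRing.Theory Num.Theory.
Import numFieldNormedType.Exports.

Local Open Scope classical_set_scope.
Local Open Scope ring_scope.

(* The two variables may live on different probability spaces. *)
Definition eq_law {R : realType} {d d' : measure_display}
    {T : measurableType d} {T' : measurableType d'}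
    (P : probability T R) (X : T -> R) (P' : probability T' R) (Y : T' -> R) :=
  forall A : set R, measurable A -> P (X @^-1` A) = P' (Y @^-1` A).

(* Taking some of A, B, C equal to setT gives the product rule for the
   subfamilies. *)
Definition mutually_independent3 {R : realType} {d : measure_display}
    {T : measurableType d} (P : probability T R) (X Y Z : T -> R) :=
  forall A B C : set R, measurable A -> measurable B -> measurable C ->
    P (X @^-1` A `&` Y @^-1` B `&` Z @^-1` C) =
    (P (X @^-1` A) * P (Y @^-1` B) * P (Z @^-1` C))%E.

Definition Phi {R : realType} (x : R) : R :=
  fine (normal_prob 0 1 (`]-oo, x] : set R)).

Definition expC {R : realType} (z : R[i]) : R[i] :=
  ((expR (complex.Re z))%:C * (cos (complex.Im z) +i* sin (complex.Im z)))%C.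

Definition char_fun {R : realType} {d : measure_display}
    {T : measurableType d} (P : probability T R) (X : T -> R) (t : R) : R[i] :=
  (fine 'E_P[fun w => cos (t * X w)]%E +i* fine 'E_P[fun w => sin (t * X w)]%E)%C.

Definition stable_char_fun {R : realType} (alpha theta t : R) : R[i] :=
  expC (- ((`|t| `^ alpha)%:C
           * expC (- (0 +i* (pi * theta * alpha * Num.sg t / 2)))))%C.

(* The strictly stable law is specified by its characteristic function and not
   by a density, because for alpha = theta = 1 it is the point mass at 1. *)
Definition strictly_stable {R : realType} {d : measure_display}
    {T : measurableType d} (P : probability T R) (S : T -> R)
    (alpha theta : R) :=
  forall t : R, char_fun P S t = stable_char_fun alpha theta t.

Definition asym_weibull_cdf {R : realType} (a1 a2 gamma x : R) : R :=
  if x <= 0 then a1 / (a1 + a2) * expR (- ((a2 * `|x|) `^ gamma))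
  else 1 - a2 / (a1 + a2) * expR (- ((a1 * x) `^ gamma)).

Definition asym_weibull {R : realType} {d : measure_display}
    {T : measurableType d} (P : probability T R) (W : T -> R)
    (a1 a2 gamma : R) :=
  forall x : R, P [set w | W w < x] = (asym_weibull_cdf a1 a2 gamma x)%:E.

(* Main.v *)
Require Import Defs.
From HB Require Import structures.
From mathcomp Require Import all_boot all_order all_algebra.
From mathcomp Require Import complex.
From mathcomp Require Import all_classical all_reals all_analysis.
From mathcomp Require Import measurable_realfun ring lra.

Import Order.TTheory GRing.Theory Num.Theory.
Import numFieldNormedType.Exports.

Local Open Scope classical_set_scope.
Local Open Scope ring_scope.

(* The law of [sigma / sqrt lambda * X * sqrt W1 + mu * W1 / lambda] is an
   asymmetric Laplace law, with tails [c exp (- b |u|)]; it is found by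
   conditioning on [W1] and exhibiting a primitive of
   [exp (- w) * Phi (alpha / sqrt w + beta * sqrt w)].  Multiplying by [2 / S]
   turns each tail into a Laplace transform [E exp (- y S)], equal to
   [exp (- y ^ gamma)], which gives the two branches of the Weibull law.

   The Laplace transform has to be recovered from the characteristic function
   [exp (- (- i t) ^ gamma)] alone, without knowing that [S >= 0].  For [e > 0],
   Fubini and the Gaussian Fourier transform express
   [E exp (- (e S) ^ 2 / 2 - y S)] as the integral of the characteristic
   function at [e t] against a Gaussian shifted by [i y / e]; as
   [exp (- (- i z) ^ gamma)] is holomorphic and bounded in the upper half-plane
   (this is where [gamma <= 1] is used), the shift can be moved onto that
   function.  Letting [e] tend to [0] gives [E exp (- y S) = exp (- y ^ gamma)]
   for every [y > 0], and [y] tending to infinity gives [S > 0] almost surely. *)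

(** * Shifting the line of integration *)

(** The obstacle is the passage from real to imaginary frequencies: until [S > 0] is known,
    [exp (- y S)] may fail to be integrable, so Fubini cannot be applied to it directly. With the
    factor [exp (- (e S) ^ 2 / 2)] every integral converges absolutely; this factor increases to 1
    as [e] decreases to 0, so its removal is a monotone limit, which yields the integrability of
    [exp (- y S)] together with its integral. The contour argument is carried out in real
    coordinates. The function to be shifted, [exp (- c (- i z) ^ gamma - (z - i eta) ^ 2 / 2)] with
    [z = t + i y], is an exponential built on an exponential of a logarithm, so stability of the
    Cauchy-Riemann equations under [exp] supplies its derivatives. The factor [c] becomes
    [e ^ gamma]: by homogeneity, [e ^ gamma (- i z) ^ gamma = (- i e z) ^ gamma], which moves [e]
    into the argument, where [e] tending to 0 is a matter of continuity. *)

Lemma Rdominated_convergence {R : realType} {d : measure_display}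
    {T : measurableType d} (mu : {measure set T -> \bar R}) (D : set T)
    (f_ : nat -> T -> R) (f g : T -> R) :
  measurable D ->
  (forall n, measurable_fun D (f_ n)) -> measurable_fun D f ->
  {ae mu, forall x, D x -> f_ ^~ x @ \oo --> f x} ->
  mu.-integrable D (EFin \o g) ->
  (forall n x, D x -> `|f_ n x| <= g x) ->
  (\int[mu]_(x in D) f_ n x)%R @[n --> \oo] --> (\int[mu]_(x in D) f x)%R.
Proof.
move=> mD mf_ mf f_f ig f_g.
have [||||intf _ cvgf] := @dominated_convergence _ _ _ mu D mD
  (fun n x => (f_ n x)%:E) (EFin \o f) (EFin \o g) _ _ _ ig.
- by move=> n; exact/measurable_EFinP.
- exact/measurable_EFinP.
- apply: filterS f_f => x + Dx => /(_ Dx) f_fx.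
  by apply/fine_cvgP; split; [exact: nearW|exact: f_fx].
- by apply: aeW => x n Dx; rewrite lee_fin f_g.
apply: fine_cvg; move: cvgf; rewrite fineK //.
exact: integrable_fin_num intf.
Qed.

Lemma integrable_le {R : realType} {d : measure_display}
    {T : measurableType d} (mu : {measure set T -> \bar R}) (D : set T)
    (f g : T -> R) :
  measurable D -> measurable_fun D f -> mu.-integrable D (EFin \o g) ->
  (forall x, D x -> `|f x| <= g x) -> mu.-integrable D (EFin \o f).
Proof.
move=> mD mf ig fg; apply: le_integrable ig => //; first exact/measurable_EFinP.
by move=> x Dx /=; rewrite lee_fin (le_trans (fg _ Dx)) ?ler_norm.
Qed.

(* For [H = u + i v] holomorphic in [t + i y] (of which only
   [du/dy = - dv/dt] is needed), Cauchy's theorem on the rectangle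
   [-N, N] x [y, eta]. *)
Section horizontal_shift.
Context {R : realType}.
Local Notation mu := (@lebesgue_measure R).
Variables (u v w : R -> R -> R) (u0 K : R -> R) (eta : R).
Hypothesis eta_gt0 : 0 < eta.
Hypothesis du : forall y t : R, 0 < y -> is_derive y 1 (u ^~ t) (- w y t).
Hypothesis dv : forall y t : R, 0 < y -> is_derive t 1 (v y) (w y t).
Hypothesis cu : forall y : R, 0 < y -> continuous (u y).
Hypothesis cw : forall y : R, 0 < y -> continuous (w y).
Hypothesis w_bounded : forall y1 N : R, 0 < y1 -> exists M : R, forall y t : R,
  y1 < y < eta + 1 -> `|t| <= N -> `|w y t| <= M.
Hypothesis u_le : forall y t : R, 0 < y < eta + 1 -> `|u y t| <= K t.
Hypothesis v_le : forall y t : R, 0 < y < eta + 1 -> `|v y t| <= K t.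
Hypothesis u0_le : forall t, `|u0 t| <= K t.
Hypothesis mu0 : measurable_fun setT u0.
Hypothesis u_u0 : forall t : R, t != 0 -> u y t @[y --> 0^'+] --> u0 t.
Hypothesis intK : mu.-integrable setT (EFin \o K).
Hypothesis K_cvg0 : K n%:R + K (- n%:R) @[n --> \oo] --> 0.

Let Q (N : nat) (y : R) := (\int[mu]_(t in `[(- N%:R)%R, N%:R]) u y t)%R.

Let mu_u y : 0 < y -> measurable_fun setT (u y).
Proof. by move=> y0; apply: continuous_measurable_fun; exact: cu. Qed.

Let int_u y : 0 < y < eta + 1 -> mu.-integrable setT (EFin \o u y).
Proof.
move=> /[dup] y01 /andP[y0 y1]; apply: integrable_le intK _ => //.
- exact: mu_u.
- by move=> t _; exact: u_le.
Qed.

Let int_wE N y : 0 < y ->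
  (\int[mu]_(t in `[(- N.+1%:R)%R, N.+1%:R]) - w y t)%R =
  - (v y N.+1%:R - v y (- N.+1%:R)).
Proof.
move=> y0.
have N0 : (- N.+1%:R : R) < N.+1%:R by rewrite -subr_gt0 opprK addr_gt0 ?ltr0n.
have cv : continuous (v y).
  move=> t; apply/differentiable_continuous/derivable1_diffP.
  exact: (@ex_derive _ _ _ _ _ _ _ (dv y t y0)).
have cwN : {within `[(- N.+1%:R)%R, N.+1%:R], continuous (fun t => - w y t)}.
  apply: continuous_subspaceT => t; apply: (@continuousN _ R^o _ (w y)).
  exact: cw.
rewrite /Rintegral (@continuous_FTC2 _ (fun t => - w y t) (fun t => - v y t)
  _ _ N0 cwN) /= ?EFinN //.
- by rewrite opprB /= opprK addrC.

- split.
  + move=> t _; apply: derivableN.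
    exact: (@ex_derive _ _ _ _ _ _ _ (dv y t y0)).
  + by apply: cvg_at_right_filter; apply: (@cvgN _ R^o); exact: cv.
  + by apply: cvg_at_left_filter; apply: (@cvgN _ R^o); exact: cv.
- move=> t _; rewrite derive1E deriveN; last first.
    exact: (@ex_derive _ _ _ _ _ _ _ (dv y t y0)).
  by rewrite (@derive_val _ _ _ _ _ _ _ (dv y t y0)).
Qed.

Let is_derive_Q N y : 0 < y < eta + 1 ->
  is_derive y 1 (Q N.+1) (- (v y N.+1%:R - v y (- N.+1%:R))).
Proof.
move=> /andP[y0 y1].
have [M wM] := w_bounded (y / 2) N.+1%:R ltac:(by rewrite divr_gt0).
(* Differentiation under the integral needs an open range of heights around [y]. It stays above
   [y / 2] because [w] is controlled only away from height 0, and it overshoots [eta] so that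
   [y = eta] is covered too. *)
have Iy : `]y / 2, eta + 1[%classic y.
  by rewrite /= in_itv/= y1 andbT ltr_pdivrMr// ltr_pMr// ltr1n.
have mI : measurable (`[(- N.+1%:R)%R,
  N.+1%:R] : set (measurableTypeR R)) by [].
have pos x : `]y / 2, eta + 1[%classic x -> 0 < x < eta + 1.
  rewrite /= in_itv/= => /andP[h ->]; rewrite andbT.
  by apply: lt_trans h; rewrite divr_gt0.
have iu x : `]y / 2, eta + 1[%classic x ->
    mu.-integrable `[(- N.+1%:R)%R, N.+1%:R] (EFin \o u x).
  by move=> /pos xx; apply: integrableS (int_u x xx).
have d1u x t : `]y / 2, eta + 1[%classic x -> partial1of2 u x t = - w x t.
  move=> /pos /andP[x0 _]; rewrite partial1of2E.
  exact: (@derive_val _ _ _ _ _ _ _ (du x t x0)).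
have der x (t : measurableTypeR R) : `]y / 2,
  eta + 1[%classic x -> `[(- N.+1%:R)%R, N.+1%:R]%classic t ->
   derivable (u ^~ t) x 1.
  move=> /pos /andP[x0 _] _; exact: (@ex_derive _ _ _ _ _ _ _ (du x t x0)).
have G0 (t : measurableTypeR R) : 0 <= `|M| by [].
have iG : mu.-integrable `[(- N.+1%:R)%R, N.+1%:R] (EFin \o (fun=> `|M|)).
  apply: continuous_compact_integrable; first exact: segment_compact.
  by apply: continuous_subspaceT => ?; exact: cvg_cst.
have ub x (t : measurableTypeR R) : `]y / 2,
  eta + 1[%classic x -> `[(- N.+1%:R)%R, N.+1%:R]%classic t ->
    `|partial1of2 u x t| <= `|M|.
  move=> xI; rewrite /= in_itv/= => tN; rewrite d1u// normrN.
  apply: le_trans (ler_norm _).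
  by apply: wM; [move: xI; rewrite /= in_itv|rewrite ler_norml].
apply: DeriveDef.
  have := derivable_under_integral mI Iy iu der G0 iG ub; exact.
rewrite -derive1E (differentiation_under_integral mI Iy iu der G0 iG ub).
rewrite -(int_wE N y y0); apply: eq_Rintegral => t _.
by rewrite d1u.
Qed.

(** By the mean value theorem, since the derivative of [Q] is the difference of [v] on the two
    vertical sides. The length [eta - y] is weakened to [eta] to make the bound uniform as [y] tends
    to 0. *)
Let Q_le N y : 0 < y < eta ->
  `|Q N.+1 eta - Q N.+1 y| <= (K N.+1%:R + K (- N.+1%:R)) * eta.
Proof.
move=> /andP[y0 yeta].
have pos x : x \in `[y, eta] -> 0 < x < eta + 1.
  rewrite in_itv/= => /andP[yx xe]; rewrite (lt_le_trans y0 yx)/=.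
  by rewrite (le_lt_trans xe)// ltrDl.
have dQ x : x \in `]y, eta[ ->
    is_derive x 1 (Q N.+1) (- (v x N.+1%:R - v x (- N.+1%:R))).
  by move=> /subset_itv_oo_cc /pos; exact: is_derive_Q.
have cQ : {within `[y, eta], continuous (Q N.+1)}.
  apply: derivable_within_continuous => x /pos xx.
  exact: (@ex_derive _ _ _ _ _ _ _ (is_derive_Q N x xx)).
have [c /subset_itv_oo_cc /pos cc ->] := MVT yeta dQ cQ.
rewrite normrM normrN; apply: ler_pM => //.
  rewrite (le_trans (ler_normB _ _))// lerD// v_le//.
rewrite ger0_norm ?subr_ge0 ?(ltW yeta)// lerBlDr lerDl ltW//.
Qed.

Let Q0_le N :
  `|Q N.+1 eta - (\int[mu]_(t in `[(- N.+1%:R)%R, N.+1%:R]) u0 t)%R| <=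
    (K N.+1%:R + K (- N.+1%:R)) * eta.
Proof.
(* [harmonic n] is [1 / (n + 1)], so the factor [eta / 2] keeps all these heights strictly below
   [eta]. *)
pose y_ (n : nat) : R := eta / 2 * harmonic n.
have y_gt0 n : 0 < y_ n by rewrite /y_ mulr_gt0 ?divr_gt0// invr_gt0.
have y_lt n : 0 < y_ n < eta.
  rewrite y_gt0 /=; apply: (@le_lt_trans _ _ (eta / 2)).
    apply: ler_piMr; first by rewrite divr_ge0// ltW.
    by rewrite /harmonic /= invf_le1 ?ler1n ?ltr0n.
  by rewrite ltr_pdivrMr// ltr_pMr// ltr1n.
have y_lt1 n : 0 < y_ n < eta + 1.
  have /andP[-> /= h] := y_lt n; by rewrite (lt_trans h)// ltrDl.
have y_cvg : y_ n @[n --> \oo] --> 0.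
  by rewrite -[X in _ --> X](mulr0 (eta / 2)); apply: cvgM;
    [exact: cvg_cst|exact: cvg_harmonic].
have QQ : Q N.+1 (y_ n) @[n --> \oo] -->
    (\int[mu]_(t in `[(- N.+1%:R)%R, N.+1%:R]) u0 t)%R.
  apply: (@Rdominated_convergence _ _ (measurableTypeR R) mu _
    (fun n => u (y_ n)) u0 K) => //.
  - by move=> n; apply: measurable_funTS; exact: mu_u.
  - exact: measurable_funTS.
  (* The origin is the branch point, where no convergence is assumed; it is Lebesgue-null. *)
  - exists [set 0]; split => //; first exact: lebesgue_measure_set1.
    move=> t /=; apply: contra_notP => /eqP t0 _.
    by have /cvg_at_rightP := u_u0 t t0; apply.
  - exact: integrableS intK.
  - by move=> n t _; exact: u_le.
have cvgd : `|Q N.+1 eta - Q N.+1 (y_ n)| @[n --> \oo] -->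
    `|Q N.+1 eta - (\int[mu]_(t in `[(- N.+1%:R)%R, N.+1%:R]) u0 t)%R|.
  by apply: (@cvg_norm _ R^o); apply: (@cvgB _ R^o) => //; exact: cvg_cst.
rewrite -(cvg_lim _ cvgd)//; apply: limr_le.
  by apply/cvg_ex; eexists; exact: cvgd.
by apply: nearW => n; exact: Q_le.
Qed.

Let cvg_itv (f : R -> R) : measurable_fun setT f -> (forall t, `|f t| <= K t) ->
  (\int[mu]_(t in `[(- N.+1%:R)%R, N.+1%:R]) f t)%R @[N --> \oo] -->
  (\int[mu]_t f t)%R.
Proof.
move=> mf fK.
under eq_fun do rewrite Rintegral_mkcond.
apply: (@Rdominated_convergence _ _ (measurableTypeR R) mu _
  (fun N => f \_ (`[(- N.+1%:R)%R, N.+1%:R])) f K) => //.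
- by move=> n; apply/measurable_restrict => //; exact: measurable_funTS.
- apply: aeW => t _; apply: (@cvg_near_cst _ R^o).
  exists (Num.truncn `|t|) => // n /= tn.
  rewrite patchE mem_set//= in_itv/= -ler_norml.
  apply/ltW; apply: lt_le_trans (truncnS_gt _) _.
  by rewrite ler_nat.
- move=> n t _; rewrite patchE; case: ifP => // _.
  by rewrite normr0 (le_trans _ (fK t)).
Qed.

Lemma horizontal_shift : (\int[mu]_t u eta t)%R = (\int[mu]_t u0 t)%R.
Proof.
have eta1 : 0 < eta < eta + 1 by rewrite eta_gt0 ltrDl ltr01.
have h : `|Q N.+1 eta - (\int[mu]_(t in `[(- N.+1%:R)%R, N.+1%:R]) u0 t)%R|
    @[N --> \oo] --> `|(\int[mu]_t u eta t)%R - (\int[mu]_t u0 t)%R|.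
  apply: (@cvg_norm _ R^o); apply: (@cvgB _ R^o); last exact: cvg_itv.
  by apply: cvg_itv; [exact: mu_u|move=> t; exact: u_le].
have h0 : (fun N : nat => (K N.+1%:R + K (- N.+1%:R)) * eta) N @[N --> \oo] -->
  0.
  rewrite -[X in _ --> X](mul0r eta); apply: cvgM; last exact: cvg_cst.
  by move: K_cvg0; rewrite -(cvg_shiftS (fun n => K n%:R + K (- n%:R))).
apply/eqP; rewrite -subr_eq0 -normr_le0 -(cvg_lim _ h)// -[leRHS](cvg_lim _
  h0)//.
apply: ler_lim; [by apply/cvg_ex; eexists; exact: h|by apply/cvg_ex; eexists;
  exact: h0|].
by apply: nearW => N; exact: Q0_le.
Qed.

End horizontal_shift.

(** * The characteristic function off the real line *)

(** The height [y] is the first argument of [u] and [v], and [du + i dv] is the complex derivative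
    of [u + i v] with respect to [t + i y]. *)
Definition cauchy_riemann {R : realType} (u v : R -> R -> R) (y t du dv : R) :=
  [/\ is_derive t 1 (u y) du, is_derive t 1 (v y) dv,
      is_derive y 1 (u ^~ t) (- dv) & is_derive y 1 (v ^~ t) du].

(** The rule [(exp f)' = f' exp f] in coordinates. It is applied twice: to [gamma log (y - i t)],
    giving the power, and then to the full exponent. *)
Lemma cauchy_riemann_exp {R : realType} (u v : R -> R -> R) (y t du dv : R) :
  cauchy_riemann u v y t du dv ->
  cauchy_riemann (fun y t => expR (u y t) * cos (v y t))
    (fun y t => expR (u y t) * sin (v y t)) y t
    (expR (u y t) * (cos (v y t) * du - sin (v y t) * dv))
    (expR (u y t) * (sin (v y t) * du + cos (v y t) * dv)).
Proof.
move=> [ut vt uy vy].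
have eut := is_derive1_comp (is_derive_expR (u y t)) ut.
have euy := is_derive1_comp (is_derive_expR (u y t)) uy.
have cvt := is_derive1_comp (is_derive_cos (v y t)) vt.
have cvy := is_derive1_comp (is_derive_cos (v y t)) vy.
have svt := is_derive1_comp (is_derive_sin (v y t)) vt.
have svy := is_derive1_comp (is_derive_sin (v y t)) vy.
split.
- apply: is_derive_eq (is_deriveM eut cvt) _; rewrite /GRing.scale/=; ring.
- apply: is_derive_eq (is_deriveM eut svt) _; rewrite /GRing.scale/=; ring.
- apply: is_derive_eq (is_deriveM euy cvy) _; rewrite /GRing.scale/=; ring.
- apply: is_derive_eq (is_deriveM euy svy) _; rewrite /GRing.scale/=; ring.
Qed.

Lemma gaussianE {R : realType} (t : R) :
  expR (- (t ^+ 2 / 2)) = (normal_peak (1 : R))^-1 * normal_pdf 0 1 t.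
Proof.
rewrite normal_pdfE ?oner_eq0// mulrA mulVf ?mul1r; last first.
  by rewrite gt_eqF// normal_peak_gt0// oner_eq0.
by rewrite /normal_fun subr0 expr1n mulNr.
Qed.

Lemma integrable_gaussian {R : realType} :
  (@lebesgue_measure R).-integrable setT
    (EFin \o (fun t : R => expR (- (t ^+ 2 / 2)))).
Proof.
rewrite (_ : _ \o _ = fun t : R =>
    ((normal_peak (1 : R))^-1%:E * (normal_pdf 0 1 t)%:E)%E).
  by apply: integrableZl => //; exact: integrable_normal_pdf.
by apply/funext => t; rewrite /= gaussianE EFinM.
Qed.

Lemma cvg_gaussian_nat {R : realType} :
  (expR (- ((n%:R : R) ^+ 2 / 2))) @[n --> \oo] --> (0 : R).
Proof.
have h : expR (- ((n%:R : R) / 2)) @[n --> \oo] --> (0 : R).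
  have : expR (- 2^-1) ^+ n @[n --> \oo] --> (0 : R).
    by apply: cvg_expr; rewrite ger0_norm ?expR_ge0// expR_lt1 oppr_lt0.
  apply: cvg_trans; apply: near_eq_cvg; apply: nearW => n.
  by rewrite -expRM_natl mulrN.
apply: (@squeeze_cvgr _ _ _ _ (cst 0) _ _ _ _ _ h); last exact: cvg_cst.
apply: nearW => n.
rewrite expR_ge0 ler_expR lerN2 ler_pM2r ?invr_gt0//.
by rewrite -natrX ler_nat; case: n => // n; rewrite expnS leq_pmulr// expn_gt0.
Qed.

Lemma measurable_sgr {R : realType} : measurable_fun setT (@Num.sg R).
Proof.
apply: nondecreasing_measurable => // x y xy.
have [y0|y0|y0] := ltgtP y 0; last by rewrite y0 sgr0 sgr_le0 -y0.
- by rewrite !ltr0_sg// (le_lt_trans xy).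
- rewrite (gtr0_sg y0); case: (ltgtP x 0) => [x0|x0|->].
  + by rewrite ltr0_sg// (@le_trans _ _ 0)// lerN10.
  + by rewrite gtr0_sg.
  + by rewrite sgr0.
Qed.

(** The boundary value, up to sign, of the argument of [y - i t]; it produces the [Num.sg t] of the
    stable characteristic function. *)
Lemma cvg_atan_div_right0 {R : realType} (t : R) : t != 0 ->
  atan (t / y) @[y --> 0^'+] --> Num.sg t * (pi / 2).
Proof.
have pos (s : R) : 0 < s -> atan (s / y) @[y --> 0^'+] --> pi / 2.
  move=> s0; apply: (cvg_comp _ _ _ (@cvgy_atan R)).
  apply: gt0_cvgMry => //; apply/gtr0_cvgV0.
    by near=> y; rewrite invr_gt0; near: y; exact: nbhs_right_gt.
  rewrite (_ : unstable.inv_fun _ = id); last by apply/funext => y;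
    rewrite /= invrK.
  by apply: cvg_at_right_filter; exact: cvg_id.
move=> t0; case: (ltgtP t 0) t0 => // t0 _.
- rewrite ltr0_sg// mulN1r.
  rewrite (_ : (fun y : R => atan (t / y)) = (fun y : R => - atan (- t / y))).
    by apply: (@cvgN _ R^o); apply: pos; rewrite oppr_gt0.
  by apply/funext => y; rewrite mulNr atanN opprK.
- by rewrite gtr0_sg// mul1r; exact: pos.
Unshelve. all: by end_near. Qed.

(* Real and imaginary part of the principal value of [(y - i t) ^ gamma]. *)
Definition branch_re {R : realType} (gamma y t : R) : R :=
  expR (gamma / 2 * ln (t ^+ 2 + y ^+ 2)) * cos (- gamma * atan (t / y)).
Definition branch_im {R : realType} (gamma y t : R) : R :=
  expR (gamma / 2 * ln (t ^+ 2 + y ^+ 2)) * sin (- gamma * atan (t / y)).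

(** The argument of [y - i t] lies between [- pi / 2] and [pi / 2], and multiplying it by
    [gamma <= 1] keeps it there, so its cosine is nonnegative. *)
Lemma branch_re_ge0 {R : realType} (gamma y t : R) :
  0 < gamma -> gamma <= 1 -> 0 <= branch_re gamma y t.
Proof.
move=> gamma0 gamma1; rewrite mulr_ge0 ?expR_ge0//.
have pi2 : 0 < pi / 2 :> R by rewrite divr_gt0// pi_gt0.
have := @atan_ltpi2 _ (t / y); have := @atan_gtNpi2 _ (t / y).
move: (atan _) => x h1 h2; apply: cos_ge0_pihalf.
have : `|gamma * x| <= pi / 2.
  rewrite normrM (gtr0_norm gamma0); apply: (@le_trans _ _ `|x|);
    first by rewrite ler_piMl.
  by rewrite ler_norml ltW//= ltW.
by rewrite mulNr -ler_norml normrN.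
Qed.

Section stable_exponent.
Context {R : realType}.
Variables (gamma c eta : R).
Hypotheses (gamma_gt0 : 0 < gamma) (gamma_le1 : gamma <= 1) (c_ge0 : 0 <= c)
  (eta_gt0 : 0 < eta).
Let gamma_ge0 : 0 <= gamma := ltW gamma_gt0.

(** [p + i q] is [gamma log (y - i t)], and [dp + i dq] below is its derivative
    [- i gamma / (y - i t)]. *)
Let p (y t : R) : R := gamma / 2 * ln (t ^+ 2 + y ^+ 2).
Let q (y t : R) : R := - gamma * atan (t / y).

Let sq_gt0 (y t : R) : 0 < y -> 0 < t ^+ 2 + y ^+ 2.
Proof. by move=> y0; rewrite ltr_wpDl ?sqr_ge0 ?exprn_gt0. Qed.

Let dp (y t : R) : R := gamma * t / (t ^+ 2 + y ^+ 2).
Let dq (y t : R) : R := - (gamma * y / (t ^+ 2 + y ^+ 2)).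

Let cr_pq (y t : R) : 0 < y -> cauchy_riemann p q y t (dp y t) (dq y t).
Proof.
move=> y0; have s0 := sq_gt0 y t y0.
have yne : y != 0 by rewrite gt_eqF.
have sne : t ^+ 2 + y ^+ 2 != 0 by rewrite gt_eqF.
have lnd := is_derive1_ln s0.
have hne : 1 + (t / y) ^+ 2 != 0 by rewrite gt_eqF// ltr_pwDl// sqr_ge0.
have st : is_derive t 1 (fun t : R => t ^+ 2 + y ^+ 2) (2 * t).
  by apply: is_derive_eq; rewrite /GRing.scale/=; ring.
have sy : is_derive y 1 (fun y : R => t ^+ 2 + y ^+ 2) (2 * y).
  by apply: is_derive_eq; rewrite /GRing.scale/=; ring.
have at' : is_derive t 1 (fun t : R => t / y) y^-1.
  by apply: is_derive_eq; rewrite /GRing.scale/=; ring.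
have ay : is_derive y 1 (fun y : R => t / y) (- t / y ^+ 2).
  have := @is_deriveV _ (fun y : R => y) y 1 1 yne (is_derive_id _ _).
  move=> /(is_deriveZ t) h; apply: is_derive_eq h _.
  by rewrite /GRing.scale/=; field.
have dat := is_derive1_atan (t / y).
split; rewrite ?/p ?/q.
- have h := is_deriveZ (gamma / 2) (@is_derive1_comp _ _ (fun t : R => t ^+ 2 +
  y ^+ 2) _ _ _ lnd st); apply: is_derive_eq h _.
  rewrite /GRing.scale/= /dp; field; rewrite ?yne ?sne ?hne //.
- apply: is_derive_eq (@is_deriveM _ _ (cst (- gamma)) _ _ _ _ _ (is_derive_cst
  _ _ _) (@is_derive1_comp _ _ (fun t : R => t / y) _ _ _ dat at')) _.
  rewrite /GRing.scale/= /dq; field; rewrite ?yne ?sne ?hne //.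
- have h := is_deriveZ (gamma / 2) (@is_derive1_comp _ _ (fun y : R => t ^+ 2 +
  y ^+ 2) _ _ _ lnd sy); apply: is_derive_eq h _.
  rewrite /GRing.scale/= /dq; field; rewrite ?yne ?sne ?hne //.
- apply: is_derive_eq (@is_deriveM _ _ (cst (- gamma)) _ _ _ _ _ (is_derive_cst
  _ _ _) (@is_derive1_comp _ _ (fun y : R => t / y) _ _ _ dat ay)) _.
  rewrite /GRing.scale/= /dp; field; rewrite ?yne ?sne ?hne //.
Qed.

Let A (y t : R) : R := branch_re gamma y t.
Let B (y t : R) : R := branch_im gamma y t.
Let dA (y t : R) : R := expR (p y t) * (cos (q y t) * dp y t - sin (q y t) * dq
  y t).
Let dB (y t : R) : R := expR (p y t) * (sin (q y t) * dp y t + cos (q y t) * dq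
  y t).

(** [a + i b] is the exponent [- c (y - i t) ^ gamma - (t + i (y - eta)) ^ 2 / 2]. The Gaussian part
    is centred at height [eta], so it is real there and carries the shift by [i eta] at height 0. *)
Let a (y t : R) : R := - c * A y t - (t ^+ 2 - (y - eta) ^+ 2) / 2.
Let b (y t : R) : R := - c * B y t - t * (y - eta).
Let da (y t : R) : R := - c * dA y t - t.
Let db (y t : R) : R := - c * dB y t - (y - eta).

Let cr_AB (y t : R) : 0 < y -> cauchy_riemann A B y t (dA y t) (dB y t).
Proof. by move=> y0; apply: cauchy_riemann_exp; exact: cr_pq. Qed.

Let cr_ab (y t : R) : 0 < y -> cauchy_riemann a b y t (da y t) (db y t).
Proof.
move=> y0; have [At Bt Ay By] := cr_AB y t y0.
have ct (f : R -> R) (x df : R) : is_derive x 1 f df -> is_derive x 1 (fun x :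
  R => - c * f x) (- c * df).
  by move=> h; exact: (is_deriveZ (- c) h).
have st : is_derive t 1 (fun t : R => (t ^+ 2 - (y - eta) ^+ 2) / 2) t.
  by apply: is_derive_eq; rewrite /GRing.scale/=; field.
have sy : is_derive y 1 (fun y : R => (t ^+ 2 - (y - eta) ^+ 2) / 2) (- (y -
  eta)).
  by apply: is_derive_eq; rewrite /GRing.scale/=; field.
have lt : is_derive t 1 (fun t : R => t * (y - eta)) (y - eta).
  by apply: is_derive_eq; rewrite /GRing.scale/=; ring.
have ly : is_derive y 1 (fun y : R => t * (y - eta)) t.
  by apply: is_derive_eq; rewrite /GRing.scale/=; ring.
split.
- exact: (is_deriveB (ct _ _ _ At) st).
- exact: (is_deriveB (ct _ _ _ Bt) lt).
- apply: is_derive_eq (is_deriveB (ct _ _ _ Ay) sy) _.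
  rewrite /db; ring.
- exact: (is_deriveB (ct _ _ _ By) ly).
Qed.

Let u (y t : R) : R := expR (a y t) * cos (b y t).
Let v (y t : R) : R := expR (a y t) * sin (b y t).
Let w (y t : R) : R := expR (a y t) * (sin (b y t) * da y t + cos (b y t) * db
  y t).

Let cr_uv (y t : R) : 0 < y -> exists du, cauchy_riemann u v y t du (w y t).
Proof. by move=> y0; eexists; apply: cauchy_riemann_exp; exact: cr_ab. Qed.

Let derivable_cts (f : R -> R) (df : R -> R) :
  (forall t : R, is_derive t 1 f (df t)) -> continuous f.
Proof.
move=> h t; apply/differentiable_continuous/derivable1_diffP.
exact: (@ex_derive _ _ _ _ _ _ _ (h t)).
Qed.

Let cts_w y : 0 < y -> continuous (w y).
Proof.
move=> y0.
have cp : continuous (p y).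
  by apply: (@derivable_cts _ (dp y)) => t; have [] := cr_pq y t y0.
have cq : continuous (q y).
  by apply: (@derivable_cts _ (dq y)) => t; have [] := cr_pq y t y0.
have ca : continuous (a y).
  by apply: (@derivable_cts _ (da y)) => t; have [] := cr_ab y t y0.
have cb : continuous (b y).
  by apply: (@derivable_cts _ (db y)) => t; have [] := cr_ab y t y0.
have cexp (f : R -> R) : continuous f -> continuous (fun x => expR (f x)).
  by move=> cf x; apply: continuous_comp; [exact: cf|exact: continuous_expR].
have ccos (f : R -> R) : continuous f -> continuous (fun x => cos (f x)).
  by move=> cf x; apply: continuous_comp; [exact: cf|exact: continuous_cos].
have csin (f : R -> R) : continuous f -> continuous (fun x => sin (f x)).
  by move=> cf x; apply: continuous_comp; [exact: cf|exact: continuous_sin].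
have cst' (k : R) : continuous (fun _ : R => k) by move=> ?; exact: cvg_cst.
have mul (f h : R -> R) : continuous f -> continuous h -> continuous (fun x =>
  f x * h x).
  by move=> cf ch x; apply: cvgM; [exact: cf|exact: ch].
have add (f h : R -> R) : continuous f -> continuous h -> continuous (fun x =>
  f x + h x).
  by move=> cf ch x; apply: (@cvgD _ R^o); [exact: cf|exact: ch].
have opp (f : R -> R) : continuous f -> continuous (fun x => - f x).
  by move=> cf x; apply: (@cvgN _ R^o); exact: cf.
have inv : continuous (fun t : R => (t ^+ 2 + y ^+ 2)^-1).
  move=> t; apply: cvgV; first by rewrite gt_eqF// sq_gt0.
  by apply: (@cvgD _ R^o); [exact: exprn_continuous|exact: cvg_cst].
have idc : continuous (fun t : R => t) by move=> ?; exact: cvg_id.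
have cdp : continuous (dp y).
  exact: (mul _ _ (mul _ _ (cst' _) idc) inv).
have cdq : continuous (dq y).
  exact: (opp _ (mul _ _ (cst' _) inv)).
have cda : continuous (da y).
  exact: (add _ _ (mul _ _ (cst' _) (mul _ _ (cexp _ cp)
    (add _ _ (mul _ _ (ccos _ cq) cdp) (opp _ (mul _ _ (csin _ cq) cdq)))))
    (opp _ idc)).
have cdb : continuous (db y).
  exact: (add _ _ (mul _ _ (cst' _) (mul _ _ (cexp _ cp)
    (add _ _ (mul _ _ (csin _ cq) cdp) (mul _ _ (ccos _ cq) cdq))))
    (cst' _)).
exact: (mul _ _ (cexp _ ca)
  (add _ _ (mul _ _ (csin _ cb) cda) (mul _ _ (ccos _ cb) cdb))).
Qed.

Let a_le (y t : R) : 0 < y < eta + 1 -> a y t <= (eta ^+ 2 + 1) / 2 - t ^+ 2 /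
  2.
Proof.
move=> /andP[y0 y1]; rewrite /a.
have : 0 <= c * A y t by rewrite mulr_ge0//; exact: branch_re_ge0.
(* [y - eta] lies between [- eta] and 1; the sum [eta ^ 2 + 1] covers both ends. *)
have : (y - eta) ^+ 2 <= eta ^+ 2 + 1 by nra.
by rewrite mulNr; lra.
Qed.
Let w_bounded (y1 N : R) : 0 < y1 -> exists M : R, forall y t : R,
  y1 < y < eta + 1 -> `|t| <= N -> `|w y t| <= M.
Proof.
move=> y1_gt0.
(* [E] bounds the modulus [s ^ (gamma / 2)], where [s = t ^ 2 + y ^ 2]: that modulus is at most 1 if
   [s <= 1] and at most [s] otherwise. The terms [y1^-1] bound [dp] and [dq], the parts of a number
   of modulus [gamma / |y - i t|]; [N] and [eta + 1] bound [t] and [y - eta]; the exponential comes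
   from [a_le]. *)
pose E := 1 + N ^+ 2 + (eta + 1) ^+ 2.
exists (expR ((eta ^+ 2 + 1) / 2) *
  ((c * (E * (y1^-1 + y1^-1)) + N) + (c * (E * (y1^-1 + y1^-1)) + (eta + 1)))).
move=> y t /andP[y1y yeta] tN.
have y0 : 0 < y by exact: lt_trans y1y.
have N0 : 0 <= N by exact: le_trans tN.
have s0 := sq_gt0 y t y0.
have y1V : 0 <= y1^-1 by rewrite invr_ge0 ltW.
have E0 : 0 <= E by rewrite /E !addr_ge0// sqr_ge0.
have sE : t ^+ 2 + y ^+ 2 <= N ^+ 2 + (eta + 1) ^+ 2.
  rewrite lerD//; first by rewrite -(real_normK (num_real t)) lerXn2r ?nnegrE.
  by rewrite lerXn2r ?nnegrE ?addr_ge0 ?ltW.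
have pE : expR (p y t) <= E.
  have [s1|s1] := leP (t ^+ 2 + y ^+ 2) 1.
    apply: (@le_trans _ _ 1); last by rewrite /E -addrA lerDl addr_ge0//
      sqr_ge0.
    rewrite expR_le1 /p mulr_ge0_le0 ?divr_ge0//.
    by rewrite ln_le0.
  apply: (@le_trans _ _ (t ^+ 2 + y ^+ 2)); last first.
    by rewrite /E -addrA (le_trans sE)// lerDr.
  rewrite -[leRHS]lnK ?posrE// ler_expR /p.
  have l0 : 0 <= ln (t ^+ 2 + y ^+ 2) by rewrite ln_ge0// ltW.
  apply: ler_piMl => //.
  by rewrite ler_pdivrMr// mul1r (le_trans gamma_le1)// ler1n.
have dpE : `|dp y t| <= y1^-1.
  rewrite /dp normrM normfV (gtr0_norm s0) ler_pdivrMr// normrM (ger0_norm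
    gamma_ge0).
  apply: (@le_trans _ _ `|t|); first by rewrite ler_piMl.
  rewrite -(ler_pM2l y1_gt0) mulrA divff ?gt_eqF// mul1r.
  rewrite -[t ^+ 2](real_normK (num_real t)).
  have : 0 <= `|t| by [].
  move: (`|t|) => r r0.
  have : y1 * r <= y * r by rewrite ler_wpM2r// ltW.
  nra.
have dqE : `|dq y t| <= y1^-1.
  rewrite /dq normrN normrM normfV (gtr0_norm s0) ler_pdivrMr// normrM
    (ger0_norm gamma_ge0).
  rewrite (gtr0_norm y0).
  apply: (@le_trans _ _ y); first by rewrite ler_piMl// ltW.
  rewrite -(ler_pM2l y1_gt0) mulrA divff ?gt_eqF// mul1r.
  have : y1 * y <= y * y by rewrite ler_wpM2r// ltW.
  have := sqr_ge0 t; rewrite !expr2; lra.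
have trig2 (x1 x2 d1 d2 D1 D2 : R) : `|x1| <= 1 -> `|x2| <= 1 -> `|d1| <= D1 ->
  `|d2| <= D2 ->
    `|x1 * d1 + x2 * d2| <= D1 + D2.
  move=> h1 h2 h3 h4; apply: le_trans (ler_normD _ _) _.
  by apply: lerD; rewrite normrM; [apply: le_trans h3|apply: le_trans h4];
    exact: ler_piMl.
have dAE : `|dA y t| <= E * (y1^-1 + y1^-1).
  rewrite /dA normrM ger0_norm ?expR_ge0//; apply: ler_pM; rewrite ?expR_ge0//.
  rewrite -mulNr; apply: trig2 => //; first exact: cos_max.
  by rewrite normrN sin_max.
have dBE : `|dB y t| <= E * (y1^-1 + y1^-1).
  rewrite /dB normrM ger0_norm ?expR_ge0//; apply: ler_pM; rewrite ?expR_ge0//.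
  by apply: trig2 => //; [exact: sin_max|exact: cos_max].
have cn (d D : R) : `|d| <= D -> `|- c * d| <= c * D.
  by move=> dD; rewrite normrM normrN (ger0_norm c_ge0) ler_wpM2l.
have daE : `|da y t| <= c * (E * (y1^-1 + y1^-1)) + N.
  rewrite /da (le_trans (ler_normB _ _))// lerD//.
  exact: cn.
have dbE : `|db y t| <= c * (E * (y1^-1 + y1^-1)) + (eta + 1).
  rewrite /db (le_trans (ler_normB _ _))// lerD//.
    exact: cn.
  have e0 : 0 <= eta by exact: ltW.
  have y1' := ltW y0.
  have y2' := ltW yeta.
  rewrite ler_norml; apply/andP; split.
    by rewrite lerBrDr opprD addrAC addNr add0r (le_trans _ y1')// lerN10.
  by rewrite lerBlDr (le_trans y2')// lerDl.
rewrite /w normrM ger0_norm ?expR_ge0//; apply: ler_pM; rewrite ?expR_ge0//;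
  last first.
  by apply: trig2 => //; [exact: sin_max|exact: cos_max].
rewrite ler_expR; apply: (le_trans (a_le y t _)); first by rewrite y0.
by rewrite lerBlDr lerDl divr_ge0// sqr_ge0.
Qed.

Let K (t : R) : R := expR ((eta ^+ 2 + 1) / 2) * expR (- (t ^+ 2 / 2)).
(** At height 0 the power [(- i t) ^ gamma] is [|t| ^ gamma exp (- i kappa)], which is the exponent
    in the stable characteristic function; [a0] and [b0] are the resulting limits of [a] and [b]. *)
Let kappa (t : R) : R := pi * gamma * Num.sg t / 2.
Let a0 (t : R) : R :=
  - c * (`|t| `^ gamma * cos (kappa t)) - (t ^+ 2 - eta ^+ 2) / 2.
Let b0 (t : R) : R := c * (`|t| `^ gamma * sin (kappa t)) + t * eta.
Let u0 (t : R) : R := expR (a0 t) * cos (b0 t).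

Let expa_le (y t : R) : 0 < y < eta + 1 -> expR (a y t) <= K t.
Proof. by move=> y01; rewrite /K -expRD ler_expR a_le. Qed.

Let cos_kappa_ge0 t : 0 <= cos (kappa t).
Proof.
have pi2 : 0 < pi / 2 :> R by rewrite divr_gt0// pi_gt0.
apply: cos_ge0_pihalf; rewrite -ler_norml /kappa.
rewrite (_ : _ / 2 = (gamma * Num.sg t) * (pi / 2)); last by field.
rewrite normrM (gtr0_norm pi2); apply: ler_piMl; first exact: ltW.
rewrite normrM (ger0_norm gamma_ge0).
by rewrite -[leRHS]mulr1 ler_pM// normr_sg; case: (t == 0).
Qed.

Let exp_cos_le (x y z : R) : expR x <= z -> `|expR x * cos y| <= z.
Proof.
by move=> xz; rewrite normrM ger0_norm ?expR_ge0// (le_trans _ xz)// ler_piMr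
  ?expR_ge0 ?cos_max.
Qed.

Let exp_sin_le (x y z : R) : expR x <= z -> `|expR x * sin y| <= z.
Proof.
by move=> xz; rewrite normrM ger0_norm ?expR_ge0// (le_trans _ xz)// ler_piMr
  ?expR_ge0 ?sin_max.
Qed.

Let u0_le (t : R) : `|u0 t| <= K t.
Proof.
apply: exp_cos_le; rewrite /K -expRD ler_expR /a0.
have : 0 <= c * (`|t| `^ gamma * cos (kappa t)).
  by rewrite mulr_ge0// mulr_ge0 ?powR_ge0.
by rewrite mulNr; lra.
Qed.

Let measurable_u0 : measurable_fun setT u0.
Proof.
have mk : measurable_fun setT kappa.
  apply: measurable_funM => //; apply: measurable_funM => //;
    exact: measurable_sgr.
have mp : measurable_fun setT (fun t : R => `|t| `^ gamma).
  by apply: (measurableT_comp (measurable_powR _)).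
apply: measurable_funM.
  apply: (measurableT_comp (@measurable_expR R)); apply: measurable_funB.
    apply: measurable_funM => //; apply: measurable_funM => //.
    by apply: measurableT_comp mk; apply: continuous_measurable_fun;
      exact: continuous_cos.
  apply: measurable_funM => //; apply: measurable_funB => //;
    exact: exprn_measurable.
apply: measurableT_comp; first by apply: continuous_measurable_fun;
  exact: continuous_cos.
apply: measurable_funD; last exact: measurable_funM.
apply: measurable_funM => //; apply: measurable_funM => //.
by apply: measurableT_comp mk; apply: continuous_measurable_fun;
  exact: continuous_sin.
Qed.

Let u_cvg (t : R) : t != 0 -> u y t @[y --> 0^'+] --> u0 t.
Proof.
move=> t0.
have nt0 : 0 < `|t| by rewrite normr_gt0.
have cp : expR (p y t) @[y --> 0^'+] --> `|t| `^ gamma.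
  apply: cvg_at_right_filter.
  (* For [t != 0] the argument of the logarithm stays positive at height 0, so the limit is the
     value there by continuity. *)
  rewrite (_ : `|t| `^ gamma = expR (p 0 t)); last first.
    rewrite /powR gt_eqF// /p expr0n addr0 -(real_normK (num_real t)) lnXn//.
    by congr expR; field.
  apply: continuous_comp; last exact: continuous_expR.
  apply: cvgM; first exact: cvg_cst.
  apply: continuous_comp; last first.
    by apply: continuous_ln; rewrite expr0n addr0 exprn_even_gt0.
  by apply: (@cvgD _ R^o); [exact: cvg_cst|exact: exprn_continuous].
have cq : q y t @[y --> 0^'+] --> - kappa t.
  rewrite (_ : - kappa t = - gamma * (Num.sg t * (pi / 2)));
    last by rewrite /kappa; field.
  by apply: cvgM; [exact: cvg_cst|exact: cvg_atan_div_right0].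
have cA : A y t @[y --> 0^'+] --> `|t| `^ gamma * cos (kappa t).
  apply: cvgM => //; rewrite -(cosN (kappa t)).
  exact: (cvg_comp _ _ cq (@continuous_cos R _)).
have cB : B y t @[y --> 0^'+] --> - (`|t| `^ gamma * sin (kappa t)).
  rewrite -mulrN; apply: cvgM => //; rewrite -(sinN (kappa t)).
  exact: (cvg_comp _ _ cq (@continuous_sin R _)).
have cy : y - eta @[y --> 0^'+] --> - eta.
  apply: cvg_at_right_filter; rewrite -[X in _ --> X](add0r (- eta)).
  by apply: (@cvgD _ R^o); [exact: cvg_id|exact: cvg_cst].
have ca : a y t @[y --> 0^'+] --> a0 t.
  apply: (@cvgB _ R^o); first by apply: cvgM => //; exact: cvg_cst.
  apply: cvgM; last exact: cvg_cst.
  apply: (@cvgB _ R^o); first exact: cvg_cst.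
  by rewrite -(sqrrN eta); apply: cvgM.
have cb : b y t @[y --> 0^'+] --> b0 t.
  rewrite (_ : b0 t = - c * - (`|t| `^ gamma * sin (kappa t)) - t * - eta);
    last first.
    by rewrite /b0; ring.
  apply: (@cvgB _ R^o); first by apply: cvgM => //; exact: cvg_cst.
  by apply: cvgM => //; exact: cvg_cst.
apply: cvgM.
- exact: (cvg_comp _ _ ca (@continuous_expR R _)).
- exact: (cvg_comp _ _ cb (@continuous_cos R _)).
Qed.

(** The two sides are the integrals along heights [eta] and 0. On the left the Gaussian is real and
    the power is taken off the real line; on the right it is the other way round. *)
Lemma branch_shift :
  (\int[lebesgue_measure]_t (expR (- c * branch_re gamma eta t - t ^+ 2 / 2) *
     cos (- c * branch_im gamma eta t)))%R =
  (\int[lebesgue_measure]_t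
    (expR (- c * (`|t| `^ gamma * cos (pi * gamma * Num.sg t / 2))
             - (t ^+ 2 - eta ^+ 2) / 2) *
     cos (c * (`|t| `^ gamma * sin (pi * gamma * Num.sg t / 2)) + t * eta)))%R.
Proof.
transitivity (\int[lebesgue_measure]_t u eta t)%R.
  apply: eq_Rintegral => t _; rewrite /u /a /b subrr expr0n subr0 mulr0 subr0
    //.
apply: (@horizontal_shift _ u v w u0 K eta eta_gt0).
- by move=> y t y0; have [du []] := cr_uv y t y0.
- by move=> y t y0; have [du []] := cr_uv y t y0.
- move=> y y0 t; apply/differentiable_continuous/derivable1_diffP.
  by have [du [h _ _ _]] := cr_uv y t y0; exact: (@ex_derive _ _ _ _ _ _ _ h).
- exact: cts_w.
- exact: w_bounded.
- by move=> y t y01; apply: exp_cos_le; exact: expa_le.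
- by move=> y t y01; apply: exp_sin_le; exact: expa_le.
- exact: u0_le.
- exact: measurable_u0.
- exact: u_cvg.
- rewrite (_ : _ \o _ = fun t : R =>
    ((expR ((eta ^+ 2 + 1) / 2))%:E * (expR (- (t ^+ 2 / 2)))%:E)%E).
    by apply: integrableZl => //; exact: integrable_gaussian.
  by apply/funext => t; rewrite /= EFinM.
- rewrite -[X in _ --> X](addr0 0); apply: (@cvgD _ R^o).
    rewrite -[X in _ --> X](mulr0 (expR ((eta ^+ 2 + 1) / 2))).
    by apply: cvgM; [exact: cvg_cst|exact: cvg_gaussian_nat].
  rewrite -[X in _ --> X](mulr0 (expR ((eta ^+ 2 + 1) / 2))).
  apply: cvgM; first exact: cvg_cst.
  by under eq_fun do rewrite sqrrN; exact: cvg_gaussian_nat.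
Qed.
End stable_exponent.

(** * The Laplace transform of the one-sided stable law *)

Lemma Rintegral_Fubini {R : realType} {d1 d2 : measure_display}
    {T1 : measurableType d1} {T2 : measurableType d2}
    (m1 : {sigma_finite_measure set T1 -> \bar R})
    (m2 : {sigma_finite_measure set T2 -> \bar R}) (f : T1 * T2 -> R) :
  (m1 \x m2)%E.-integrable setT (EFin \o f) ->
  (forall x, m2.-integrable setT (fun y => (f (x, y))%:E)) ->
  (forall y, m1.-integrable setT (fun x => (f (x, y))%:E)) ->
  (\int[m1]_x (\int[m2]_y f (x, y)))%R = (\int[m2]_y (\int[m1]_x f (x, y)))%R.
Proof.
move=> intf int2 int1; rewrite /Rintegral; congr fine.
transitivity (\int[m1]_x \int[m2]_y (f (x, y))%:E)%E.
  by apply: eq_integral => x _; rewrite fineK//;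
    exact: (integrable_fin_num _ (int2 x)).
rewrite (Fubini intf); apply: eq_integral => y _.
by rewrite fineK//; exact: (integrable_fin_num _ (int1 y)).
Qed.

(** Kept unevaluated: it enters as a positive factor that is divided out in
    [cvg_gaussian_moment]. *)
Definition gaussian_mass {R : realType} : R :=
  (\int[@lebesgue_measure R]_t expR (- (t ^+ 2 / 2)))%R.

Lemma gaussian_mass_gt0 {R : realType} : 0 < @gaussian_mass R.
Proof.
rewrite /gaussian_mass; under eq_Rintegral do rewrite gaussianE.
rewrite RintegralZl//; last exact: integrable_normal_pdf.
by rewrite /Rintegral integral_normal_pdf mulr1 invr_gt0 normal_peak_gt0//.
Qed.

Lemma continuous_gaussian {R : realType} :
  continuous (fun t : R => expR (- (t ^+ 2 / 2))).
Proof.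
move=> t; apply: continuous_comp; last exact: continuous_expR.
apply: (@cvgN _ R^o); apply: cvgM; last exact: cvg_cst.
exact: exprn_continuous.
Qed.

Lemma continuous_shifted_gaussian {R : realType} (k : R) :
  continuous (fun t : R => expR (k - t ^+ 2 / 2)).
Proof.
move=> t; apply: continuous_comp; last exact: continuous_expR.
apply: (@cvgB _ R^o); first exact: cvg_cst.
by apply: cvgM; [exact: exprn_continuous|exact: cvg_cst].
Qed.

Lemma integrable_shifted_gaussian {R : realType} (k : R) :
  (@lebesgue_measure R).-integrable setT
    (EFin \o (fun t : R => expR (k - t ^+ 2 / 2))).
Proof.
rewrite (_ : _ \o _ = fun t : R =>
    ((expR k)%:E * (expR (- (t ^+ 2 / 2)))%:E)%E).
  by apply: integrableZl => //; exact: integrable_gaussian.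
by apply/funext => t; rewrite /= expRD EFinM.
Qed.

(** The case [c = 0] of [branch_shift], where only the Gaussian is left; the exponent 1 passed to it
    is an arbitrary admissible value. Parity in [x] extends the result from [x > 0]. *)
Lemma gaussian_cos {R : realType} (x : R) :
  (\int[lebesgue_measure]_t (expR (- (t ^+ 2 / 2)) * cos (t * x)))%R =
  gaussian_mass * expR (- (x ^+ 2 / 2)).
Proof.
have pos (eta : R) : 0 < eta ->
    (\int[lebesgue_measure]_t (expR (- (t ^+ 2 / 2)) * cos (t * eta)))%R =
    gaussian_mass * expR (- (eta ^+ 2 / 2)).
  move=> eta0.
  have := @branch_shift R 1 0 eta ltr01 (lexx 1) (lexx 0) eta0.
  under eq_Rintegral do rewrite oppr0 !mul0r cos0 mulr1 sub0r.
  under [X in _ = X -> _]eq_Rintegral => t _.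
    rewrite oppr0 !mul0r sub0r add0r.
    rewrite (_ : - ((t ^+ 2 - eta ^+ 2) / 2) = eta ^+ 2 / 2 - t ^+ 2 / 2);
      last by field.
    rewrite expRD -mulrA; over.
  rewrite RintegralZl//; last first.
    apply: integrable_le integrable_gaussian _ => //.
      apply: continuous_measurable_fun => t.
      apply: cvgM; first exact: continuous_gaussian.
      apply: continuous_comp; last exact: continuous_cos.
      by apply: cvgM; [exact: cvg_id|exact: cvg_cst].
    by move=> t _; rewrite normrM ger0_norm ?expR_ge0// ler_piMr ?expR_ge0
      ?cos_max.
  by rewrite -/gaussian_mass => ->; rewrite mulrAC -expRD subrr expR0 mul1r.
have [x0|x0|->] := ltgtP x 0; last first.
- under eq_Rintegral do rewrite mulr0 cos0 mulr1.
  by rewrite expr0n mul0r oppr0 expR0 mulr1.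
- exact: pos.
- rewrite -sqrrN -pos ?oppr_gt0//; apply: eq_Rintegral => t _.
  by rewrite mulrN cosN.
Qed.

Section scaling.
Context {R : realType}.
Implicit Types (gamma y t e : R).

Let scale_modulus gamma y t e : 0 < y -> 0 < e ->
  e `^ gamma * expR (gamma / 2 * ln (t ^+ 2 + (y / e) ^+ 2)) =
  expR (gamma / 2 * ln ((e * t) ^+ 2 + y ^+ 2)).
Proof.
move=> y0 e0; rewrite /powR gt_eqF// -expRD; congr expR.
have s0 : 0 < t ^+ 2 + (y / e) ^+ 2.
  by rewrite ltr_wpDl ?sqr_ge0 ?exprn_gt0 ?divr_gt0.
rewrite (_ : (e * t) ^+ 2 + y ^+ 2 = e ^+ 2 * (t ^+ 2 + (y / e) ^+ 2));
  last first.
  by field; rewrite gt_eqF.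
by rewrite lnM ?posrE ?exprn_gt0// lnXn//; field.
Qed.

Let scale_arg y t e : 0 < y -> 0 < e -> t / (y / e) = e * t / y.
Proof. by move=> y0 e0; field; rewrite !gt_eqF. Qed.

(** Real part of [e ^ gamma (y / e - i t) ^ gamma = (y - i e t) ^ gamma]: a positive scale changes
    the modulus and leaves the argument alone. *)
Lemma branch_re_scale gamma y t e : 0 < y -> 0 < e ->
  e `^ gamma * branch_re gamma (y / e) t = branch_re gamma y (e * t).
Proof.
by move=> y0 e0; rewrite /branch_re mulrA scale_modulus// scale_arg.
Qed.

Lemma branch_im_scale gamma y t e : 0 < y -> 0 < e ->
  e `^ gamma * branch_im gamma (y / e) t = branch_im gamma y (e * t).
Proof.
by move=> y0 e0; rewrite /branch_im mulrA scale_modulus// scale_arg.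
Qed.

Lemma branch_re0 gamma y : 0 < y -> branch_re gamma y 0 = y `^ gamma.
Proof.
move=> y0; rewrite /branch_re mul0r atan0 mulr0 cos0 mulr1 expr0n add0r.
by rewrite /powR gt_eqF// lnXn//; congr expR; field.
Qed.

Lemma branch_im0 gamma y : branch_im gamma y 0 = 0.
Proof. by rewrite /branch_im mul0r atan0 mulr0 sin0 mulr0. Qed.

Let continuous_modulus gamma y : 0 < y ->
  continuous (fun t => expR (gamma / 2 * ln (t ^+ 2 + y ^+ 2))).
Proof.
move=> y0 t; apply: continuous_comp; last exact: continuous_expR.
apply: cvgM; first exact: cvg_cst.
apply: continuous_comp; last first.
  by apply: continuous_ln; rewrite ltr_wpDl ?sqr_ge0 ?exprn_gt0.
by apply: (@cvgD _ R^o); [exact: exprn_continuous|exact: cvg_cst].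
Qed.

Let continuous_arg gamma y : 0 < y -> continuous (fun t => - gamma * atan (t /
  y)).
Proof.
move=> y0 t; apply: cvgM; first exact: cvg_cst.
apply: continuous_comp; last exact: continuous_atan.
by apply: cvgM; [exact: cvg_id|exact: cvg_cst].
Qed.

Lemma continuous_branch_re gamma y : 0 < y -> continuous (branch_re gamma y).
Proof.
move=> y0 t; apply: cvgM; first exact: continuous_modulus.
by apply: continuous_comp; [exact: continuous_arg|exact: continuous_cos].
Qed.

Lemma continuous_branch_im gamma y : 0 < y -> continuous (branch_im gamma y).
Proof.
move=> y0 t; apply: cvgM; first exact: continuous_modulus.
by apply: continuous_comp; [exact: continuous_arg|exact: continuous_sin].
Qed.
End scaling.

Lemma stable_char_funE {R : realType} {d : measure_display}
    {T : measurableType d} (P : probability T R) (S : T -> R) (gamma t : R) :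
  strictly_stable P S gamma 1 ->
  let kappa := pi * gamma * Num.sg t / 2 in
  fine 'E_P[fun w => cos (t * S w)]%E =
    expR (- (`|t| `^ gamma * cos kappa)) * cos (`|t| `^ gamma * sin kappa) /\
  fine 'E_P[fun w => sin (t * S w)]%E =
    expR (- (`|t| `^ gamma * cos kappa)) * sin (`|t| `^ gamma * sin kappa).
Proof.
move=> /(_ t); rewrite /char_fun /stable_char_fun /expC /= mulr1.
move=> [-> ->].
by rewrite oppr0 expR0 !mul0r !mul1r !subr0 !addr0 cosN sinN mulrN opprK.
Qed.

Section laplace.
Context {R : realType} {d : measure_display} {T : measurableType d}.
Variables (P : probability T R) (S : {RV P >-> R}) (gamma : R).
Hypotheses (gamma_gt0 : 0 < gamma) (gamma_le1 : gamma <= 1)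
  (stS : strictly_stable P S gamma 1).

Let measurable_lin (a b : R) : measurable_fun setT (fun w => a * S w + b).
Proof. by apply: measurable_funD => //; apply: measurable_funM. Qed.

Let measurable_cosS (a b : R) : measurable_fun setT (fun w => cos (a * S w +
  b)).
Proof.
apply: measurableT_comp (measurable_lin a b).
by apply: continuous_measurable_fun; exact: continuous_cos.
Qed.

Let measurable_sinS (a b : R) : measurable_fun setT (fun w => sin (a * S w +
  b)).
Proof.
apply: measurableT_comp (measurable_lin a b).
by apply: continuous_measurable_fun; exact: continuous_sin.
Qed.

Let integrable_bounded (f : T -> R) (M : R) : measurable_fun setT f ->
  (forall w, `|f w| <= M) -> P.-integrable setT (EFin \o f).
Proof.
move=> mf fM; apply: (integrable_le _ _ _ (fun=> M)) => //.
exact: finite_measure_integrable_cst.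
Qed.

Let int_cosS (a b : R) : P.-integrable setT (EFin \o (fun w => cos (a * S w +
  b))).
Proof. by apply: (integrable_bounded _ 1) => // w; exact: cos_max. Qed.

Let int_sinS (a b : R) : P.-integrable setT (EFin \o (fun w => sin (a * S w +
  b))).
Proof. by apply: (integrable_bounded _ 1) => // w; exact: sin_max. Qed.

(** The real part of the characteristic function at [s] multiplied by [exp (i b)]; the phase [b]
    will carry the Gaussian shift. *)
Let cos_moment (s b : R) : let kappa := pi * gamma * Num.sg s / 2 in
  (\int[P]_w cos (s * S w + b))%R =
  expR (- (`|s| `^ gamma * cos kappa)) * cos (`|s| `^ gamma * sin kappa + b).
Proof.
move=> kappa; have [hc hs] := stable_char_funE P S gamma s stS.
have ic := int_cosS s 0; have is' := int_sinS s 0.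
under eq_Rintegral do rewrite -[s * S _]addr0 cosD.
rewrite RintegralB//=; last 2 first.
- exact: (integrableZr _ _ ic).
- exact: (integrableZr _ _ is').
rewrite !RintegralZr//.
rewrite (_ : (\int[P]_w cos (s * S w + 0))%R = fine 'E_P[fun w => cos (s * S
  w)]%E); last first.
  by rewrite /Rintegral expectation.unlock; congr fine;
    apply: eq_integral => w _ /=; rewrite addr0.
rewrite (_ : (\int[P]_w sin (s * S w + 0))%R = fine 'E_P[fun w => sin (s * S
  w)]%E); last first.
  by rewrite /Rintegral expectation.unlock; congr fine;
    apply: eq_integral => w _ /=; rewrite addr0.
by rewrite hc hs cosD; rewrite /kappa; ring.
Qed.

Let gaussian_cos_le (k t x : R) :
  `|expR (k - t ^+ 2 / 2) * cos x| <= expR (k - t ^+ 2 / 2).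
Proof.
by rewrite normrM ger0_norm ?expR_ge0// ler_piMr ?expR_ge0 ?cos_max.
Qed.

Let Fubini_gaussian (k a b : R) :
  (\int[lebesgue_measure]_t (\int[P]_w
     (expR (k - t ^+ 2 / 2) * cos (t * (a * S w + b)))))%R =
  (\int[P]_w (\int[lebesgue_measure]_t
     (expR (k - t ^+ 2 / 2) * cos (t * (a * S w + b)))))%R.
Proof.
have mg : measurable_fun setT (fun tw : measurableTypeR R * T =>
    expR (k - tw.1 ^+ 2 / 2) * cos (tw.1 * (a * S tw.2 + b))).
  have m1 : measurable_fun setT (fun tw : measurableTypeR R * T => tw.1) by
    exact: measurable_fst.
  have mS : measurable_fun setT (fun tw : measurableTypeR R * T => S tw.2).
    exact: (measurableT_comp _ measurable_snd).
  apply: measurable_funM.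
    have mgauss := continuous_measurable_fun (@continuous_shifted_gaussian R k).
    exact: (measurableT_comp mgauss m1).
  apply: measurableT_comp; first by apply: continuous_measurable_fun;
    exact: continuous_cos.
  apply: measurable_funM => //; apply: measurable_funD => //.
  exact: measurable_funM.
have mgt (t : R) : measurable_fun setT
    (fun w => expR (k - t ^+ 2 / 2) * cos (t * (a * S w + b))).
  exact: (measurableT_comp mg (@pair1_measurable _ _ (measurableTypeR R) T t)).
have mgw (w : T) : measurable_fun setT
    (fun t : measurableTypeR R => expR (k - t ^+ 2 / 2) * cos (t * (a * S w +
      b))).
  exact: (measurableT_comp mg (@pair2_measurable _ _ (measurableTypeR R) T w)).
apply: (@Rintegral_Fubini _ _ _ (measurableTypeR R) T lebesgue_measure P
  (fun tw => expR (k - tw.1 ^+ 2 / 2) * cos (tw.1 * (a * S tw.2 + b)))).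
- apply/integrable12ltyP; first exact/measurable_EFinP.
  apply: (@le_lt_trans _ _ (\int[lebesgue_measure]_t (expR (k - t ^+ 2 /
    2))%:E)%E).
    apply: ge0_le_integral => //.
    + by move=> t _; exact: integral_ge0.
    + have mf : measurable_fun setT (fun tw : measurableTypeR R * T =>
          `|(expR (k - tw.1 ^+ 2 / 2) * cos (tw.1 * (a * S tw.2 + b)))%:E|%E).
        by apply: measurableT_comp => //; exact/measurable_EFinP.
      exact: (measurable_fun_fubini_tonelli_F (m2 := P) _ mf (fun=> abse_ge0
        _)).
    + apply/measurable_EFinP; exact: (continuous_measurable_fun
      (@continuous_shifted_gaussian R k)).
    move=> t _.
    apply: (@le_trans _ _ (\int[P]_w (expR (k - t ^+ 2 / 2))%:E)%E).
      apply: ge0_le_integral => //.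
      * by apply: measurableT_comp => //; apply/measurable_EFinP; exact: mgt.
      * by move=> w _ /=; rewrite lee_fin; exact: gaussian_cos_le.
    by rewrite integral_cst//= probability_setT mule1.
  have /integrableP[_] := @integrable_shifted_gaussian R k.
  by under eq_integral do rewrite /= ger0_norm ?expR_ge0//.
- move=> t; apply: (integrable_bounded _ (expR (k - t ^+ 2 / 2))).
    exact: mgt.
  by move=> w; exact: gaussian_cos_le.
- move=> w; apply: (integrable_le _ _ _ _ measurableT (mgw w)
  (integrable_shifted_gaussian k)).
  by move=> t _; exact: gaussian_cos_le.
Qed.

Let measurable_moment (y e : R) :
  measurable_fun setT (fun w => expR (- (e * S w) ^+ 2 / 2 - y * S w)).
Proof.
apply: measurableT_comp => //; apply: measurable_funB;
  last exact: measurable_funM.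
apply: measurable_funM => //; apply: measurableT_comp => //.
by apply: measurable_funX; exact: measurable_funM.
Qed.

(** Completing the square bounds the exponent by [(y / e) ^ 2 / 2], whatever the sign of [S]. *)
Let integrable_moment (y e : R) : 0 < e ->
  P.-integrable setT (EFin \o (fun w => expR (- (e * S w) ^+ 2 / 2 - y * S w))).
Proof.
move=> e0; apply: (integrable_bounded _ (expR ((y / e) ^+ 2 / 2))) => // w.
rewrite ger0_norm ?expR_ge0// ler_expR.
rewrite (_ : y * S w = (y / e) * (e * S w)); last by field; rewrite gt_eqF.
have := sqr_ge0 (e * S w + y / e); lra.
Qed.

(* Averaging the characteristic function of [S] at [e t + i y] against a
   Gaussian in [t], the variable [t] being moved down to the real line. *)
Let gaussian_moment (y e : R) : 0 < y -> 0 < e ->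
  gaussian_mass * (\int[P]_w expR (- (e * S w) ^+ 2 / 2 - y * S w))%R =
  (\int[lebesgue_measure]_t (expR (- branch_re gamma y (e * t) - t ^+ 2 / 2) *
     cos (- branch_im gamma y (e * t))))%R.
Proof.
move=> y0 e0; set eta := y / e.
have eta0 : 0 < eta by rewrite divr_gt0.
have c0 : 0 <= e `^ gamma by exact: powR_ge0.
have im := integrable_moment y e e0.
(* By [gaussian_cos] the inner integral is the mass times [exp (eta ^ 2 / 2 - (e S + eta) ^ 2 / 2)].
   Since [e eta = y], expanding the square leaves exactly [- (e S) ^ 2 / 2 - y S]. *)
transitivity (\int[P]_w (\int[lebesgue_measure]_t
    (expR (eta ^+ 2 / 2 - t ^+ 2 / 2) * cos (t * (e * S w + eta)))))%R.
  rewrite -RintegralZl//; apply: eq_Rintegral => w _.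
  under eq_Rintegral do rewrite expRD -mulrA.
  rewrite RintegralZl//; last first.
    have ig := @integrable_shifted_gaussian R 0.
    apply: (integrable_le _ _ _ _ measurableT _ ig) => [|t _]; last first.
      by have := gaussian_cos_le 0 t (t * (e * S w + eta)); rewrite !sub0r.
    apply: continuous_measurable_fun => t.
    apply: cvgM; first exact: continuous_gaussian.
    apply: continuous_comp; last exact: continuous_cos.
    by apply: cvgM; [exact: cvg_id|exact: cvg_cst].
  rewrite gaussian_cos mulrCA; congr (_ * _); rewrite -expRD; congr expR.
  by rewrite /eta; field; rewrite gt_eqF.
(* Homogeneity rewrites the right-hand side as the height-[eta] side of [branch_shift] with
   [c = e ^ gamma]; after the shift, the integrand is [cos_moment] at [t e] with phase [t eta]. *)
under [RHS]eq_Rintegral => t _.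
  rewrite -(branch_re_scale _ _ _ _ y0 e0) -(branch_im_scale _ _ _ _ y0 e0).
  rewrite -!(mulNr (e `^ gamma)).
  over.
rewrite (@branch_shift R gamma (e `^ gamma) eta gamma_gt0 gamma_le1 c0 eta0).
rewrite -Fubini_gaussian; apply: eq_Rintegral => t _.
rewrite RintegralZl//; last first.
  by under eq_fun do rewrite mulrDr mulrA; exact: int_cosS.
under eq_Rintegral => w _ do rewrite mulrDr mulrA.
rewrite cos_moment mulrA.
have sgt : Num.sg (t * e) = Num.sg t by rewrite sgrM (gtr0_sg e0) mulr1.
rewrite sgt normrM (gtr0_norm e0) powRM ?(ltW e0)// -expRD.
congr (expR _ * cos _); first by field.
by ring.
Qed.

(** With [e = harmonic n], the point [y - i e t] tends to [y], so its power tends to [y ^ gamma].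
    The majorant is the Gaussian itself, by [branch_re_ge0]. *)
Let cvg_gaussian_moment (y : R) : 0 < y ->
  (\int[P]_w expR (- (harmonic n * S w) ^+ 2 / 2 - y * S w))%R @[n --> \oo] -->
  expR (- (y `^ gamma)).
Proof.
move=> y0; have G0 := @gaussian_mass_gt0 R.
have h0 n : 0 < harmonic n :> R by rewrite /harmonic /= invr_gt0.
have hc (t : R) : harmonic n * t @[n --> \oo] --> (0 : R).
  by rewrite -[X in _ --> X](mul0r t); apply: cvgM;
    [exact: cvg_harmonic|exact: cvg_cst].
pose F n (t : R) : R := expR (- branch_re gamma y (harmonic n * t) - t ^+ 2 /
  2) *
     cos (- branch_im gamma y (harmonic n * t)).
have cF : (\int[lebesgue_measure]_t F n t)%R @[n --> \oo] -->
    (\int[lebesgue_measure]_t (expR (- (y `^ gamma)) * expR (- (t ^+ 2 /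
      2))))%R.
  apply: (@Rdominated_convergence _ _ (measurableTypeR R) lebesgue_measure setT
    F
    (fun t => expR (- (y `^ gamma)) * expR (- (t ^+ 2 / 2)))
    (fun t => expR (- (t ^+ 2 / 2)))) => //.
  - move=> n; apply: continuous_measurable_fun => t.
    have cl : {for t, continuous (fun t : R => harmonic n * t)}.
      by apply: cvgM; [exact: cvg_cst|exact: cvg_id].
    apply: cvgM.
      apply: continuous_comp; last exact: continuous_expR.
      apply: (@cvgB _ R^o).
        apply: (@cvgN _ R^o); apply: continuous_comp => //.
        exact: continuous_branch_re.
      by apply: cvgM; [exact: exprn_continuous|exact: cvg_cst].
    apply: continuous_comp; last exact: continuous_cos.
    apply: (@cvgN _ R^o); apply: continuous_comp => //.
    exact: continuous_branch_im.
  - apply: measurable_funM => //; apply: continuous_measurable_fun.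
    exact: continuous_gaussian.
  - apply: aeW => t _; rewrite /F.
    have cre : branch_re gamma y (harmonic n * t) @[n --> \oo] --> y `^ gamma.
      rewrite -(branch_re0 _ _ y0).
      exact: (cvg_comp _ _ (hc t) (continuous_branch_re _ _ y0 _)).
    have cim : branch_im gamma y (harmonic n * t) @[n --> \oo] --> (0 : R).
      rewrite -(branch_im0 gamma y).
      exact: (cvg_comp _ _ (hc t) (continuous_branch_im _ _ y0 _)).
    have ce : - branch_re gamma y (harmonic n * t) - t ^+ 2 / 2 @[n --> \oo] -->
        - (y `^ gamma) - t ^+ 2 / 2.
      by apply: (@cvgB _ R^o); [exact: (@cvgN _ R^o)|exact: cvg_cst].
    have cc : - branch_im gamma y (harmonic n * t) @[n --> \oo] --> (0 : R).
      by rewrite -[X in _ --> X]oppr0; exact: (@cvgN _ R^o).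
    rewrite (_ : expR _ * expR _ = expR (- (y `^ gamma) - t ^+ 2 / 2) * cos 0);
      last first.
      by rewrite cos0 mulr1 expRD.
    apply: cvgM.
      exact: (cvg_comp _ _ ce (@continuous_expR R _)).
    exact: (cvg_comp _ _ cc (@continuous_cos R _)).
  - exact: integrable_gaussian.
  - move=> n t _; rewrite /F normrM ger0_norm ?expR_ge0//.
    apply: (@le_trans _ _ (expR (- branch_re gamma y (harmonic n * t) - t ^+ 2
      / 2))).
      by rewrite ler_piMr ?expR_ge0 ?cos_max.
    by rewrite ler_expR gerDr oppr_le0 branch_re_ge0.
rewrite (_ : (fun n => _) = (fun n => gaussian_mass^-1 *
  (\int[lebesgue_measure]_t F n t)%R)).
  rewrite (_ : expR (- (y `^ gamma)) = gaussian_mass^-1 *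
    (\int[lebesgue_measure]_t (expR (- (y `^ gamma)) * expR (- (t ^+ 2 /
      2))))%R).
    by apply: cvgM => //; exact: cvg_cst.
  rewrite RintegralZl//; last exact: integrable_gaussian.
  by rewrite mulrCA mulVf ?mulr1// gt_eqF.
apply/funext => n; rewrite -gaussian_moment// mulrA mulVf ?mul1r// gt_eqF//.
Qed.

(** No integrable majorant of [exp (- y S)] is at hand while [S] may be negative, so the limit is
    monotone: [- (e S) ^ 2 / 2] grows as [e] decreases. The equality is between extended reals and
    thus contains the finiteness of the left side. *)
Lemma strictly_stable_laplace (y : R) : 0 < y ->
  (\int[P]_w (expR (- y * S w))%:E = (expR (- (y `^ gamma)))%:E)%E.
Proof.
move=> y0.
have h0 n : 0 < harmonic n :> R by rewrite /harmonic /= invr_gt0.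
pose f n w := expR (- (harmonic n * S w) ^+ 2 / 2 - y * S w).
have cf : (\int[P]_w (f n w)%:E)%E @[n --> \oo] --> (expR (- (y `^ gamma)))%:E.
  rewrite (_ : (fun n => _) = (fun n => (\int[P]_w f n w)%R%:E)).
    by apply: cvg_EFin; [exact: nearW|exact: cvg_gaussian_moment].
  apply/funext => n; rewrite /Rintegral fineK//.
  exact: (integrable_fin_num _ (integrable_moment y _ (h0 n))).
have := @cvg_monotone_convergence _ _ _ P setT measurableT (fun n w => (f n
  w)%:E).
move=> mc.
have -> := cvg_unique _ cf (mc _ _ _) => //.
- apply: eq_integral => w _; apply/esym/cvg_lim => //.
  apply: cvg_EFin; first exact: nearW.
  have ch : - (harmonic n * S w) ^+ 2 / 2 - y * S w @[n --> \oo] --> - y * S w.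
    rewrite mulNr -[X in _ --> X]add0r; apply: (@cvgB _ R^o);
      last exact: cvg_cst.
    have cs : harmonic n * S w @[n --> \oo] --> (0 : R).
      by rewrite -[X in _ --> X](mul0r (S w)); apply: cvgM;
        [exact: cvg_harmonic|exact: cvg_cst].
    rewrite -[X in _ --> X](mul0r 2^-1) -oppr0 -[X in - X](mul0r 0).
    apply: cvgM; last exact: cvg_cst.
    by apply: (@cvgN _ R^o); apply: cvgM.
  exact: (cvg_comp _ _ ch (@continuous_expR R _)).
- by move=> n; apply/measurable_EFinP; exact: measurable_moment.
- by move=> n w _; rewrite lee_fin expR_ge0.
- move=> w _ n m nm; rewrite lee_fin ler_expR lerD2r ler_pM2r// lerN2 !exprMn.
  rewrite ler_wpM2r ?sqr_ge0// lerXn2r ?nnegrE ?(ltW (h0 _))//.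
  by rewrite /harmonic /= lef_pV2 ?posrE// ler_nat.
Qed.

Lemma strictly_stable_le0 : P [set w | S w <= 0] = 0.
Proof.
have mS : measurable [set w | S w <= 0].
  rewrite (_ : [set _ | _] = S @^-1` `]-oo, 0]).
    by rewrite -[X in measurable X]setTI; exact: measurable_funP.
  by apply/seteqP; split => w /=; rewrite in_itv.
pose A := [set w | S w <= 0].
(* On [A] the variable [exp (- y S)] is at least 1. The choice [y = n ^ (1 / gamma)] turns its
   expectation into [exp (- n)]; [n = 0] is apart because the transform is known for [y > 0]
   only. *)
have Pn (n : nat) : (P A <= (expR (- n%:R)%R)%:E)%E.
  have [->|n0] := eqVneq n 0%N; first by rewrite oppr0 expR0 probability_le1.
  have n0' : 0 < n%:R :> R by rewrite ltr0n lt0n.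
  have y0 : 0 < n%:R `^ gamma^-1 :> R by rewrite powR_gt0.
  have <- : (n%:R `^ gamma^-1) `^ gamma = n%:R :> R.
    by rewrite -powRrM mulVf ?gt_eqF// powRr1// ltW.
  rewrite -(strictly_stable_laplace _ y0).
  apply: (@le_trans _ _ (\int[P]_w (\1_A w)%:E)%E).
    by rewrite integral_indic// setIT.
  apply: ge0_le_integral => //.
  - by apply/measurable_EFinP; exact: measurable_indic.
  - apply/measurable_EFinP; apply: measurableT_comp => //;
    exact: measurable_funM.
  - move=> w _; rewrite lee_fin indicE; have [|_] := boolP (w \in A);
    last exact: expR_ge0.
    rewrite inE /= => Sw; rewrite -expR0 ler_expR mulNr oppr_ge0.
    by rewrite mulr_ge0_le0// ltW.
apply/eqP; rewrite eq_le measure_ge0 andbT.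
have c0 : (expR (- n%:R : R)%R)%:E @[n --> \oo] --> (0%:E : \bar R).
  by apply: cvg_EFin; [exact: nearW|exact: cvgn_expR].
suff : (P A <= limn (fun n : nat => (expR (- n%:R : R)%R)%:E))%E by rewrite
  (cvg_lim _ c0).
apply: lime_ge; first by apply/cvg_ex; eexists; exact: c0.
by apply: nearW => n; exact: Pn.
Qed.

End laplace.

(** * The exponential mixture of normal distribution functions *)

Section standard_normal_cdf.
Context {R : realType}.
Implicit Type x : R.

Lemma Phi_fin x : (Phi x)%:E = normal_prob 0 1 `]-oo, x].
Proof. by rewrite /Phi fineK// fin_num_measure. Qed.

Lemma Phi_ge0 x : 0 <= Phi x.
Proof. by rewrite -lee_fin Phi_fin. Qed.

Lemma Phi_le1 x : Phi x <= 1.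
Proof. by rewrite -lee_fin Phi_fin; exact: probability_le1. Qed.

Lemma is_derive_Phi x : is_derive x 1 Phi (normal_pdf 0 1 x).
Proof.
have int : (@lebesgue_measure R).-integrable
    [set` Interval -oo%O (BRight (x + 1))] (EFin \o normal_pdf 0 1).
  apply: (integrableS measurableT) => //; exact: integrable_normal_pdf.
have [|||dP eP] := @continuous_FTC1 R (normal_pdf 0 1) -oo%O x (x + 1) _ int.
- by rewrite ltrDl.
- by rewrite ltNyr.
- exact/continuous_normal_pdf/oner_neq0.
by apply: DeriveDef => //; rewrite -derive1E.
Qed.

Lemma continuous_Phi : continuous (@Phi R).
Proof.
move=> x; apply/differentiable_continuous/derivable1_diffP.
exact: (@ex_derive _ _ _ _ _ _ _ (is_derive_Phi x)).
Qed.

Lemma measurable_Phi : measurable_fun setT (@Phi R).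
Proof. exact: continuous_measurable_fun continuous_Phi. Qed.

(** The identity seen as a random variable under [normal_prob 0 1]: its distribution function is
    [Phi], so the general limits of distribution functions apply. *)
Let idT : measurableTypeR R -> R := idfun.
#[local] HB.instance Definition _ :=
  @isMeasurableFun.Build _ _ _ _ idT (@measurable_id _ _ setT).

Lemma cvg_Phi_pinfty : Phi x @[x --> +oo] --> (1 : R).
Proof.
apply: fine_cvg.
exact: (@cvg_cdfy1 _ _ _ (normal_prob 0 1 : probability _ R) (idT : {RV _ >->
  R})).
Qed.

Lemma cvg_Phi_ninfty : Phi x @[x --> -oo] --> (0 : R).
Proof.
apply: fine_cvg.
exact: (@cvg_cdfNy0 _ _ _ (normal_prob 0 1 : probability _ R) (idT : {RV _ >->
  R})).
Qed.

End standard_normal_cdf.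

Lemma cvg_add_pinfty {R : realType} {T : Type} (F : set_system T)
    {FF : Filter F} (f g : T -> R) (l : R) :
  f x @[x --> F] --> +oo -> g x @[x --> F] --> l -> f x + g x @[x --> F] -->
    +oo.
Proof.
move=> /cvgryPge fy gl; apply/cvgryPge => M.
have gl' : \forall x \near F, l - 1 <= g x.
  by apply: (cvgr_ge _ gl); rewrite ltrBlDr ltrDl.
by apply: filterS2 (fy (M - (l - 1))) gl' => x; rewrite lerBlDr => h1 h2;
  apply: le_trans h1 _; rewrite lerD2l.
Qed.

Lemma cvg_sqrt_pinfty {R : realType} : Num.sqrt x @[x --> +oo] --> (+oo :
  set_system R).
Proof.
apply/cvgryPge => M; near=> x.
apply: (le_trans (ler_norm M)); rewrite -sqrtr_sqr; apply: ler_wsqrtr.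
by near: x; apply: nbhs_pinfty_ge; exact: num_real.
Unshelve. all: by end_near. Qed.

Lemma cvg_invsqrt_pinfty {R : realType} : (Num.sqrt x)^-1 @[x --> +oo] --> (0 :
  R).
Proof.
apply/gtr0_cvgV0; last exact: cvg_sqrt_pinfty.
by near=> x; rewrite sqrtr_gt0; near: x; apply: nbhs_pinfty_gt; exact: num_real.
Unshelve. all: by end_near. Qed.

Lemma cvg_sqrt_right0 {R : realType} : Num.sqrt x @[x --> 0^'+] --> (0 : R).
Proof.
apply: cvg_at_right_filter; rewrite -[X in _ --> X]sqrtr0;
  exact: sqrt_continuous.
Qed.

Lemma cvg_invsqrt_right0 {R : realType} :
  (Num.sqrt x)^-1 @[x --> (0:R)^'+] --> (+oo : set_system R).
Proof.
apply/gtr0_cvgV0.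
  by near=> x; rewrite invr_gt0 sqrtr_gt0; near: x; exact: nbhs_right_gt.
rewrite (_ : unstable.inv_fun _ = Num.sqrt); first exact: cvg_sqrt_right0.
by apply/funext => x; rewrite /= invrK.
Unshelve. all: by end_near. Qed.

Section exponential_mixture.
Context {R : realType}.
Variables (alpha beta : R).

Let k (b w : R) : R := alpha / Num.sqrt w + b * Num.sqrt w.
Let dk (b w : R) : R := (b - alpha / w) / (2 * Num.sqrt w).

Let is_derive_k (b w : R) : 0 < w -> is_derive w 1 (k b) (dk b w).
Proof.
move=> w0; have r0 : 0 < Num.sqrt w by rewrite sqrtr_gt0.
have rne : Num.sqrt w != 0 by rewrite gt_eqF.
have ds := is_derive1_sqrt w0.
have dV := is_deriveV rne ds.
have := is_deriveD (is_deriveZ alpha dV) (is_deriveZ b ds).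
move=> h; apply: is_derive_eq h _.
rewrite /dk /GRing.scale/=.
have := sqr_sqrtr (ltW w0); move: (Num.sqrt w) rne => r rne <-; field.
by rewrite rne.
Qed.

Let delta : R := Num.sqrt (beta ^+ 2 + 2).
Let delta_gt0 : 0 < delta.
Proof. by rewrite sqrtr_gt0 ltr_wpDl ?sqr_ge0. Qed.
Let delta_sqr : delta ^+ 2 = beta ^+ 2 + 2.
Proof. by rewrite sqr_sqrtr// addr_ge0 ?sqr_ge0. Qed.

(** The weights are forced by [cp + cm = 1] and [(cp - cm) delta = beta]. As [dk b w] is affine in
    [b], they make the derivative of [k beta] the same combination of those of [k delta] and
    [k (- delta)]. *)
Let cp : R := (1 + beta / delta) / 2.
Let cm : R := (1 - beta / delta) / 2.
Let ep : R := expR (alpha * (delta - beta)).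
Let em : R := expR (- (alpha * (beta + delta))).

(** Integration by parts leaves [exp (- w)] times the normal density at [k beta w] times
    [dk beta w]. By [pdf_shift] and the choice of weights, this is the derivative of the combination
    in the second line. *)
Let J (w : R) : R := - (expR (- w) * Phi (k beta w)) +
  (cp * ep * Phi (k delta w) + cm * em * Phi (k (- delta) w)).

(** The condition on [s] makes the terms linear in [w] agree in [- w - (k beta w) ^ 2 / 2] and
    [- (k s w) ^ 2 / 2], so that the exponents differ by the constant [alpha (s - beta)]. *)
Let pdf_shift (s w : R) : 0 < w -> s ^+ 2 = beta ^+ 2 + 2 ->
  expR (- w) * normal_pdf 0 1 (k beta w) =
  expR (alpha * (s - beta)) * normal_pdf 0 1 (k s w).
Proof.
move=> w0 s2.
have pdfE (x : R) : normal_pdf 0 1 x = normal_peak 1 * expR (- (x ^+ 2 / 2)).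
  by rewrite gaussianE mulrA divff ?mul1r// gt_eqF// normal_peak_gt0//
    oner_neq0.
rewrite !pdfE ![expR _ * (_ * _)]mulrCA -!expRD; congr (_ * expR _).
have r0 : 0 < Num.sqrt w by rewrite sqrtr_gt0.
rewrite /k; have := sqr_sqrtr (ltW w0).
move: (Num.sqrt w) r0 => r r0 <-.
have -> : (alpha / r + s * r) ^+ 2 = (alpha / r) ^+ 2 + 2 * alpha * s + s ^+ 2
  * r ^+ 2.
  by field; rewrite gt_eqF.
by rewrite s2; field; rewrite gt_eqF.
Qed.

Let is_derive_J (w : R) : 0 < w -> is_derive w 1 J (expR (- w) * Phi (k beta
  w)).
Proof.
move=> w0; have r0 : 0 < Num.sqrt w by rewrite sqrtr_gt0.
have rne : Num.sqrt w != 0 by rewrite gt_eqF.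
have dPhi b := is_derive1_comp (is_derive_Phi (k b w)) (is_derive_k b w w0).
have dE : is_derive w 1 (fun w : R => expR (- w)) (- expR (- w)).
  have h := is_derive1_comp (is_derive_expR (- w)) (is_deriveNid w 1).
  by apply: is_derive_eq h _; rewrite mulrN1.
have := is_deriveD (is_deriveN (is_deriveM dE (dPhi beta)))
   (is_deriveD (is_deriveZ (cp * ep) (dPhi delta)) (is_deriveZ (cm * em) (dPhi
     (- delta)))).
move=> h; apply: is_derive_eq h _; rewrite /GRing.scale /=.
have h1 := pdf_shift delta w w0 delta_sqr.
have h2 := pdf_shift (- delta) w w0 (etrans (sqrrN _) delta_sqr).
rewrite -/ep in h1.
have e2 : alpha * (- delta - beta) = - (alpha * (beta + delta)) by ring.
rewrite e2 -/em in h2.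
transitivity (expR (- w) * Phi (k beta w) +
  (cp * dk delta w * (ep * normal_pdf 0 1 (k delta w)) +
   cm * dk (- delta) w * (em * normal_pdf 0 1 (k (- delta) w)) -
   dk beta w * (expR (- w) * normal_pdf 0 1 (k beta w)))); first by ring.
rewrite -h1 -h2.
have dne : delta != 0 by rewrite gt_eqF.
have key : cp * dk delta w + cm * dk (- delta) w = dk beta w.
  by rewrite /cp /cm /dk; field; rewrite rne dne gt_eqF.
rewrite -key; ring.
Qed.

Let cvg_k_pinfty (b : R) : 0 < b -> k b w @[w --> +oo] --> +oo.
Proof.
move=> b0; rewrite /k; under eq_fun do rewrite addrC.
apply: (@cvg_add_pinfty _ _ _ _ _ _ (alpha * 0)).
  by apply: gt0_cvgMry => //; exact: cvg_sqrt_pinfty.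
by apply: cvgM; [exact: cvg_cst|exact: cvg_invsqrt_pinfty].
Qed.

Let cvg_k_ninfty (b : R) : 0 < b -> k (- b) w @[w --> +oo] --> -oo.
Proof.
move=> b0; apply/cvgNry.
rewrite (_ : - _ = fun w => b * Num.sqrt w + - alpha / Num.sqrt w); last first.
  by apply/funext => w; rewrite /k /= !fctE; ring.
apply: (@cvg_add_pinfty _ _ _ _ _ _ (- alpha * 0)).
  by apply: gt0_cvgMry => //; exact: cvg_sqrt_pinfty.
by apply: cvgM; [exact: cvg_cst|exact: cvg_invsqrt_pinfty].
Qed.

(** Near 0 the term [alpha / sqrt w] dominates, so the limit does not depend on [b]: it is 0, 1 or
    [Phi 0] according to the sign of [alpha]. The left side of the identity is [J] at infinity minus
    [J] at 0. For [alpha = 0] the coefficient of [L] vanishes, so both branches have the same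
    value. *)
Let cvg_Phik_right0 : exists L : R,
  (forall b, Phi (k b w) @[w --> 0^'+] --> L) /\
  L * (1 - cp * ep - cm * em) + cp * ep =
    if alpha <= 0 then cp * ep else 1 - cm * em.
Proof.
have bs (b : R) : b * Num.sqrt w @[w --> 0^'+] --> (0 : R).
  by rewrite -[X in _ --> X](mulr0 b); apply: cvgM;
    [exact: cvg_cst|exact: cvg_sqrt_right0].
have [a0|a0|a0] := ltgtP alpha 0.
- exists 0; split; last by rewrite mul0r add0r.
  move=> b.
  have h : k b w @[w --> 0^'+] --> -oo.
    apply/cvgNry.
    rewrite (_ : - _ = fun w => - alpha / Num.sqrt w + - b * Num.sqrt w);
      last first.
      by apply/funext => w; rewrite /k /= !fctE; ring.
    apply: (cvg_add_pinfty _ _ _ _ _ (bs (- b))).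
    by apply: gt0_cvgMry; [rewrite oppr_gt0|exact: cvg_invsqrt_right0].
  exact: (cvg_comp _ _ h (@cvg_Phi_ninfty R)).
- exists 1; split; last by ring.
  move=> b.
  have h : k b w @[w --> 0^'+] --> +oo.
    apply: (cvg_add_pinfty _ _ _ _ _ (bs b)).
    by apply: gt0_cvgMry => //; exact: cvg_invsqrt_right0.
  exact: (cvg_comp _ _ h (@cvg_Phi_pinfty R)).
- exists (Phi 0); split; last first.
    rewrite /ep /em a0 !mul0r oppr0 expR0 /cp /cm.
    rewrite (_ : 1 - _ - _ = 0); last by field; rewrite gt_eqF.
    by rewrite mulr0 add0r.
  move=> b; rewrite /k a0; under eq_fun do rewrite mul0r add0r.
  exact: (cvg_comp _ _ (bs b) (@continuous_Phi R 0)).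
Qed.

Let cvg_expN_pinfty (f : R -> R) : (forall w, 0 <= f w <= 1) ->
  expR (- w) * f w @[w --> +oo] --> (0 : R).
Proof.
move=> f01; apply: (@squeeze_cvgr _ _ _ _ (cst 0) _ _ _ _ _ (@cvgr_expR R));
  last exact: cvg_cst.
apply: nearW => w; have /andP[f0 f1] := f01 w.
by rewrite mulr_ge0 ?expR_ge0//= ler_piMr ?expR_ge0.
Qed.

Let cvg_J_pinfty : J w @[w --> +oo] --> cp * ep.
Proof.
rewrite (_ : cp * ep = - 0 + (cp * ep * 1 + cm * em * 0)); last by ring.
apply: (@cvgD _ R^o).
  apply: (@cvgN _ R^o); apply: cvg_expN_pinfty => w.
  by rewrite Phi_ge0 Phi_le1.
apply: (@cvgD _ R^o); (apply: cvgM; first exact: cvg_cst).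
- exact: (cvg_comp _ _ (cvg_k_pinfty delta delta_gt0) (@cvg_Phi_pinfty R)).
- exact: (cvg_comp _ _ (cvg_k_ninfty delta delta_gt0) (@cvg_Phi_ninfty R)).
Qed.

Let f (w : R) : R := expR (- w) * Phi (k beta w).

Let f_ge0 w : 0 <= f w.
Proof. by rewrite mulr_ge0 ?expR_ge0 ?Phi_ge0. Qed.

Let continuous_f w : 0 < w -> {for w, continuous f}.
Proof.
move=> w0; apply: cvgM.
  by apply: continuous_comp; [apply: (@cvgN _ R^o);
    exact: cvg_id|exact: continuous_expR].
apply: continuous_comp; last exact: continuous_Phi.
apply/differentiable_continuous/derivable1_diffP.
exact: (@ex_derive _ _ _ _ _ _ _ (is_derive_k beta w w0)).
Qed.

Let continuous_J w : 0 < w -> {for w, continuous J}.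
Proof.
move=> w0; apply/differentiable_continuous/derivable1_diffP.
exact: (@ex_derive _ _ _ _ _ _ _ (is_derive_J w w0)).
Qed.

Let int_itv (a : R) : 0 < a ->
  (\int[lebesgue_measure]_(w in `[a,
    +oo[) (f w)%:E = (cp * ep)%:E - (J a)%:E)%E.
Proof.
move=> a0; apply: ge0_continuous_FTC2y.
- by move=> w _; exact: f_ge0.
- apply/continuous_within_itvcyP; split.
    by move=> w; rewrite in_itv/= andbT => aw; apply: continuous_f;
      exact: lt_trans aw.
  by apply: cvg_at_right_filter; exact: continuous_f.
- exact: cvg_J_pinfty.
- by move=> w aw; exact: (@ex_derive _ _ _ _ _ _ _ (is_derive_J w (lt_trans a0
  aw))).
- by apply: cvg_at_right_filter; exact: continuous_J.
- move=> w; rewrite in_itv/= andbT => aw; rewrite derive1E.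
  exact: (@derive_val _ _ _ _ _ _ _ (is_derive_J w (lt_trans a0 aw))).
Qed.

(** For independent standard normal [X] and standard exponential [W], this is the probability that
    [X sqrt W - beta W < alpha]: the distribution function of an asymmetric Laplace law at
    [alpha]. *)
Lemma exponential_mixture :
  (\int[lebesgue_measure]_(w in `]0%R, +oo[)
     (expR (- w) * Phi (alpha / Num.sqrt w + beta * Num.sqrt w))%:E =
   (if alpha <= 0 then cp * ep else 1 - cm * em)%:E)%E.
Proof.
have [L [cL <-]] := cvg_Phik_right0.
have cJ : J w @[w --> 0^'+] --> - L + (cp * ep * L + cm * em * L).
  apply: (@cvgD _ R^o).
    apply: (@cvgN _ R^o); rewrite -[X in _ --> X]mul1r; apply: cvgM;
      last exact: cL.
    have cN : - w @[w --> 0^'+] --> (0 : R).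
      apply: cvg_at_right_filter; rewrite -[X in _ --> X]oppr0.
      by apply: (@cvgN _ R^o); exact: cvg_id.
    by rewrite -[X in _ --> X]expR0;
      exact: (cvg_comp _ _ cN (@continuous_expR R _)).
  by apply: (@cvgD _ R^o); (apply: cvgM; [exact: cvg_cst|exact: cL]).
have h0 n : 0 < harmonic n :> R by rewrite /harmonic /= invr_gt0.
(* [k] is singular at 0, so the fundamental theorem is used on closed half-lines that exhaust the
   open one. *)
pose I n : set R := `[harmonic n, +oo[%classic.
have cI : (\int[lebesgue_measure]_(w in I n) (f w)%:E)%E @[n --> \oo] -->
    (\int[lebesgue_measure]_(w in \bigcup_n I n) (f w)%:E)%E.
  apply: ge0_nondecreasing_set_cvg_integral.
  - move=> n m nm; apply/subsetPset => w; rewrite /I /= !in_itv/= !andbT.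
    by apply: le_trans; rewrite /harmonic/= lef_pV2 ?posrE// ler_nat.
  - by move=> n; rewrite /I; exact: measurable_itv.
  - move=> n; apply/measurable_EFinP.
    have sub : I n `<=` `]0, +oo[%classic.
      move=> w; rewrite /I /= !in_itv/= !andbT; exact: lt_le_trans.
    have mf : measurable_fun (`]0, +oo[%classic : set R) f.
      apply: open_continuous_measurable_fun; first exact: interval_open.
      by move=> w; rewrite inE /= in_itv/= andbT; exact: continuous_f.
    exact: (measurable_funS _ sub mf).
  - by move=> n w _; rewrite lee_fin.
have UI : \bigcup_n I n = `]0, +oo[%classic.
  apply/seteqP; split => w.
    move=> [n _]; rewrite /I /= !in_itv/= !andbT; exact: lt_le_trans.
  rewrite /= in_itv/= andbT => w0; near \oo => n; exists n => //.
  rewrite /I /= in_itv/= andbT; near: n.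
  exact: (cvgr_le _ (@cvg_harmonic R) w w0).
have cE : (\int[lebesgue_measure]_(w in I n) (f w)%:E)%E @[n --> \oo] -->
    (L * (1 - cp * ep - cm * em) + cp * ep)%:E.
  under eq_fun do rewrite int_itv//.
  rewrite (_ : L * _ + _ = cp * ep - (- L + (cp * ep * L + cm * em * L)));
    last by ring.
  apply: cvg_EFin; first exact: nearW.
  apply: (@cvgB _ R^o); first exact: cvg_cst.
  move/cvg_at_rightP : cJ; apply; split => //; exact: cvg_harmonic.
rewrite UI in cI; exact: (cvg_unique _ cI cE).
Unshelve. all: by end_near. Qed.

End exponential_mixture.

(** * Independence and distribution functions *)

Definition independent2 {R : realType} {d d1 d2 : measure_display}
    {T : measurableType d} {T1 : measurableType d1} {T2 : measurableType d2}
    (P : probability T R) (X : T -> T1) (Y : T -> T2) :=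
  forall A B, measurable A -> measurable B ->
    P (X @^-1` A `&` Y @^-1` B) = (P (X @^-1` A) * P (Y @^-1` B))%E.

Section independence.
Context {R : realType} {d d1 d2 : measure_display} {T : measurableType d}
  {T1 : measurableType d1} {T2 : measurableType d2}.
Variables (P : probability T R) (X : {mfun T >-> T1}) (Y : {mfun T >-> T2}).

Definition mfun_pair (w : T) : T1 * T2 := (X w, Y w).

Let measurable_pair : measurable_fun setT mfun_pair.
Proof. exact: measurable_fun_pair. Qed.

HB.instance Definition _ :=
  @isMeasurableFun.Build _ _ _ _ mfun_pair measurable_pair.

(** The pair has the product law, and Tonelli integrates out [X] while [Y] stays a random variable
    under [P]. *)
Lemma independent2_integral (F : T1 * T2 -> \bar R) :
  independent2 P X Y -> measurable_fun setT F -> (forall z, 0 <= F z)%E ->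
  (\int[P]_w F (X w, Y w) =
   \int[P]_w \int[distribution P X]_x F (x, Y w))%E.
Proof.
move=> indXY mF F0.
transitivity (\int[distribution P mfun_pair]_z F z)%E.
  by rewrite ge0_integral_distribution.
transitivity (\int[distribution P X \x distribution P Y]_z F z)%E.
  apply: eq_measure_integral => A mA _; apply/esym.
  apply: product_measure_unique => // A1 A2 mA1 mA2.
rewrite fubini_tonelli2// ge0_integral_distribution//.
- exact: measurable_fun_fubini_tonelli_G.
- by move=> y; exact: integral_ge0.
Qed.

End independence.

(** For fixed [A], both sides are finite measures in [E]; they agree on rectangles, which are stable
    under intersection and generate the product sigma-algebra. *)
Lemma mutually_independent3_pair {R : realType} {d : measure_display}
    {T : measurableType d} (P : probability T R) (X Y Z : {RV P >-> R}) :
  mutually_independent3 P X Y Z -> independent2 P X (mfun_pair Y Z).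
Proof.
move=> ind A E mA mE.
have mXA : measurable (X @^-1` A) by rewrite -[X in measurable X]setTI;
  exact: measurable_funP.
have c0 : 0 <= fine (P (X @^-1` A)) by rewrite fine_ge0.
pose c := NngNum c0.
have cE : (c%:num%:E = P (X @^-1` A))%E by rewrite /= fineK// fin_num_measure.
pose G : set (set (R * R)) := [set A `*` B | A in measurable & B in measurable].
pose m1 := pushforward (mrestr P mXA) (mfun_pair Y Z).
pose m2 := mscale c (distribution P (mfun_pair Y Z)).
have : m1 E = m2 E.
  apply: (@measure_unique _ _ _ G (fun=> setT)) => //.
  - exact: measurable_prod_measurableType.
  - move=> _ _ [A1 mA1 [B1 mB1 <-]] [A2 mA2 [B2 mB2 <-]].
    rewrite -setXI; exists (A1 `&` A2); first exact: measurableI.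
    by exists (B1 `&` B2) => //; exact: measurableI.
  - by move=> _; exists setT => //; exists setT => //; rewrite setXTT.
  - by rewrite bigcup_const.
  - move=> _ [B mB [C mC <-]].
    have mYB : measurable (Y @^-1` B) by rewrite -[X in measurable X]setTI;
      exact: measurable_funP.
    have mZC : measurable (Z @^-1` C) by rewrite -[X in measurable X]setTI;
      exact: measurable_funP.
    have hYZ : P (Y @^-1` B `&` Z @^-1` C) = (P (Y @^-1` B) * P (Z @^-1` C))%E.
      have := ind setT B C measurableT mB mC.
      by rewrite preimage_setT setTI probability_setT mul1e.
    change (P ((Y @^-1` B `&` Z @^-1` C) `&` X @^-1` A) =
      (c%:num%:E * P (Y @^-1` B `&` Z @^-1` C))%E).
    by rewrite cE hYZ setIC setIA ind// muleA.
  - move=> _; change (P (setT `&` X @^-1` A) < +oo)%E.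
    by rewrite setTI (le_lt_trans (probability_le1 _ _))// ltry.
rewrite -cE => h.
change (P (X @^-1` A `&` mfun_pair Y Z @^-1` E) =
  (c%:num%:E * P (mfun_pair Y Z @^-1` E))%E).
by rewrite setIC.
Qed.

Lemma mutually_independent3_23 {R : realType} {d : measure_display}
    {T : measurableType d} (P : probability T R) (X Y Z : {RV P >-> R}) :
  mutually_independent3 P X Y Z -> independent2 P Y Z.
Proof.
move=> ind B C mB mC; have := ind setT B C measurableT mB mC.
by rewrite preimage_setT setTI probability_setT mul1e.
Qed.

Lemma measurable_invr {R : realType} : measurable_fun setT (fun x : R => x^-1).
Proof.
(* The identity also holds at 0, where [Num.sg] and the inverse are both 0 by convention. *)
rewrite (_ : (fun x => _) = (fun x : R => Num.sg x * `|x| `^ (- 1))).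
  apply: measurable_funM; first exact: measurable_sgr.
  exact: (measurableT_comp (measurable_powR _)).
apply/funext => x; rewrite powR_inv1//.
have [->|x0] := eqVneq x 0; first by rewrite sgr0 mul0r invr0.
by rewrite -normfV {1}(numEsg x^-1) sgrV.
Qed.

Lemma measurable_sqrtr {R : realType} : measurable_fun setT (@Num.sqrt R).
Proof. by apply: continuous_measurable_fun; exact: sqrt_continuous. Qed.

Lemma eq_law_cdf {R : realType} {d d' : measure_display}
    {T : measurableType d} {T' : measurableType d'} (P : probability T R)
    (Q : probability T' R) (X : {RV P >-> R}) (Y : {RV Q >-> R}) :
  (forall x : R, P [set w | X w < x] = Q [set w | Y w < x]) -> eq_law P X Q Y.
Proof.
move=> h A mA.
pose G := @RGenInftyO.G R.
change (distribution P X A = distribution Q Y A).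
apply: (@measure_unique _ _ _ G (fun n : nat => `]-oo, n%:R[%classic)) => //.
- exact: RGenInftyO.measurableE.
- move=> _ _ [x ->] [y ->]; exists (Num.min x y).
  by apply/seteqP; split => z /=; rewrite !in_itv/= lt_min => /andP.
- by move=> n; exists n%:R.
- apply/seteqP; split => // z _.
  exists (Num.truncn `|z|).+1 => //=; rewrite in_itv/=.
  exact: le_lt_trans (ler_norm _) (truncnS_gt _).
- by move=> _ [x ->]; have := h x.
- move=> n; apply: le_lt_trans (ltry 1); exact: probability_le1.
Qed.

(** The given density coincides almost everywhere with the Radon-Nikodym derivative, for which the
    change of variables is known. *)
Lemma integral_density {R : realType} {d : measure_display} {T : measurableType
  d}
    (mu : {sigma_finite_measure set T -> \bar R})
    (nu : {finite_measure set T -> \bar R}) (g : T -> R) (f : T -> \bar R) :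
  measurable_fun setT g ->
  (forall A, measurable A -> nu A = \int[mu]_(x in A) (g x)%:E)%E ->
  nu.-integrable setT f ->
  (\int[nu]_x f x = \int[mu]_x (f x * (g x)%:E))%E.
Proof.
move=> mg nuE intf.
have numu : nu `<< mu.
  apply/null_content_dominatesP => A mA muA0; rewrite nuE//.
  by apply: null_set_integral => //; exact/measurable_funTS/measurable_EFinP.
have mf := measurable_int _ intf.
have iRN : mu.-integrable setT (Radon_Nikodym (charge_of_finite_measure nu) mu).
  by apply: Radon_Nikodym_integrable.
rewrite -(Radon_Nikodym_change_of_variables numu measurableT intf).
apply: ae_eq_integral => //.
- by apply: emeasurable_funM => //; exact: measurable_int iRN.
- by apply: emeasurable_funM => //; exact/measurable_EFinP.
- apply: ae_eqe_mul2l; apply: integral_ae_eq => //;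
  first exact/measurable_EFinP.
  by move=> A _ mA; rewrite -Radon_Nikodym_integral// -nuE.
Qed.

(* [measurableTypeR R], on which [lebesgue_measure] lives, and [R] have the same
   measurable sets but different displays. *)
Definition to_measurableTypeR {R : realType} {T : Type} (f : T -> R) :
  T -> measurableTypeR R := f.

Section exponential_density.
Context {R : realType} {d : measure_display} {T : measurableType d}.
Variables (P : probability T R) (W : {RV P >-> R}).
Hypothesis hW : forall A : set R, measurable A ->
  distribution P W A = exponential_prob 1 A.

Let W' := to_measurableTypeR W.
Let measurable_W' : measurable_fun setT W'.
Proof. exact: (@measurable_funP _ _ _ _ _ W). Qed.
#[local] HB.instance Definition _ :=
  @isMeasurableFun.Build _ _ _ _ W' measurable_W'.

Lemma integral_exponential (f : R -> R) :
  measurable_fun setT f -> (forall w, 0 <= f w <= 1) ->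
  (\int[distribution P W]_w (f w)%:E =
   \int[lebesgue_measure]_(w in `]0%R, +oo[) (expR (- w) * f w)%:E)%E.
Proof.
move=> mf f01.
have f0 w : (0 <= (f w)%:E)%E by have /andP[] := f01 w; rewrite lee_fin.
have mfE : measurable_fun setT (EFin \o f) by exact/measurable_EFinP.
transitivity (\int[distribution P W']_w (f w)%:E)%E.
  rewrite (ge0_integral_distribution W mfE)//.
  by rewrite (ge0_integral_distribution (P := P) (W' : {mfun T >->
    measurableTypeR R}) mfE).
have intf : (distribution P W').-integrable setT (EFin \o f).
  apply: (integrable_le _ _ _ (fun=> 1)) => //.
    exact: finite_measure_integrable_cst.
  by move=> w _; have /andP[f0' f1] := f01 w; rewrite ger0_norm.
rewrite (@integral_density _ _ _ lebesgue_measure (distribution P W')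
  (exponential_pdf 1))//; last exact: measurable_exponential_pdf.
rewrite integral_itv_obnd_cbnd; last first.
  apply/measurable_funTS/measurable_EFinP; apply: measurable_funM => //.
  by apply: measurableT_comp.
rewrite [RHS]integral_mkcond; apply: eq_integral => w _.
rewrite patchE /exponential_pdf patchE; case: ifP => _; last by rewrite mule0.
by rewrite mul1r mulN1r -EFinM mulrC.
Qed.

End exponential_density.

Lemma exponential_le0 {R : realType} {d : measure_display}
    {T : measurableType d} (P : probability T R) (W : {RV P >-> R}) :
  (forall A : set R, measurable A -> distribution P W A = exponential_prob 1 A)
    ->
  P (W @^-1` `]-oo, 0]) = 0.
Proof.
move=> hW; have := hW `]-oo, 0]%classic (measurable_itv _).
rewrite /distribution /pushforward => ->; rewrite /exponential_prob.
rewrite -integral_itv_bndo_bndc; last first.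
  by apply/measurable_funTS/measurable_EFinP; exact: measurable_exponential_pdf.
by apply: integral0_eq => w; rewrite /= in_itv/= => w0;
  rewrite lt0_exponential_pdf.
Qed.

Lemma normal_prob_lt {R : realType} (x : R) :
  normal_prob 0 1 `]-oo, x[ = (Phi x)%:E.
Proof.
rewrite Phi_fin /normal_prob integral_itv_bndo_bndc//.
by apply/measurable_funTS/measurable_EFinP; exact: measurable_normal_pdf.
Qed.

Lemma le_measure_null {R : realType} {d : measure_display}
    {T : measurableType d} (P : {measure set T -> \bar R}) (A B N : set T) :
  measurable A -> measurable B -> measurable N -> P N = 0%E ->
  A `<=` B `|` N -> (P A <= P B)%E.
Proof.
move=> mA mB mN PN AB; apply: (@le_trans _ _ (P (B `|` N))).
  by apply: le_measure => //; rewrite inE//; exact: measurableU.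
have : (P (B `|` N) <= P B + P N)%E by exact: measureU2.
by rewrite PN adde0.
Qed.

(** * The conditional distribution function for a fixed value of [S] *)

Section asymmetric_laplace.
Context {R : realType}.
Variables (mu sigma lambda : R).
Hypotheses (sigma_gt0 : 0 < sigma) (lambda_gt0 : 0 < lambda).

Let D : R := Num.sqrt (mu ^+ 2 + 2 * lambda * sigma ^+ 2).
Let rl : R := Num.sqrt lambda.

(** The argument of [Phi] in the theorem at [p = (W1, S)], with [2 / S] for [V]; it is a function of
    the pair because [X] is to be compared with a variable independent of it. *)
Definition laplace_arg (x : R) (p : R * R) : R :=
  (lambda * x - mu * p.1 * (2 * p.2^-1)) /
  (sigma * Num.sqrt (lambda * p.1) * (2 * p.2^-1)).

Lemma measurable_laplace_arg (x : R) : measurable_fun setT (laplace_arg x).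
Proof.
have mV : measurable_fun setT (fun p : R * R => 2 * p.2^-1).
  by apply: measurable_funM => //; apply: (measurableT_comp measurable_invr).
have mW : measurable_fun setT (fun p : R * R => p.1) by exact: measurable_fst.
apply: measurable_funM.
  by apply: measurable_funB => //; apply: measurable_funM => //;
    exact: measurable_funM.
apply: (measurableT_comp measurable_invr).
apply: measurable_funM => //; apply: measurable_funM => //.
by apply: (measurableT_comp measurable_sqrtr); exact: measurable_funM.
Qed.

Lemma laplace_argP (x X W S : R) : 0 < W -> 0 < S ->
  ((sigma / Num.sqrt lambda * (X * Num.sqrt W) + mu * W / lambda) * (2 * S^-1)
    < x) =
  (X < laplace_arg x (W, S)).
Proof.
move=> W0 S0; rewrite /laplace_arg /=.
have rl0 : 0 < Num.sqrt lambda by rewrite sqrtr_gt0.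
have rW0 : 0 < Num.sqrt W by rewrite sqrtr_gt0.
rewrite (sqrtrM W (ltW lambda_gt0)).
have := sqr_sqrtr (ltW lambda_gt0).
move: (Num.sqrt lambda) rl0 (Num.sqrt W) rW0 => l l0 r r0 lE.
have c0 : 0 < sigma * (l * r) * (2 * S^-1) by rewrite !mulr_gt0 ?invr_gt0.
rewrite ltr_pdivlMr// -subr_gt0 -[RHS]subr_gt0.
rewrite -(pmulr_rgt0 _ lambda_gt0); congr (0 < _).
rewrite -lE; field.
by rewrite !gt_eqF.
Qed.

Let D_sqr : D ^+ 2 = mu ^+ 2 + 2 * lambda * sigma ^+ 2.
Proof. by rewrite sqr_sqrtr// addr_ge0 ?sqr_ge0// !mulr_ge0 ?sqr_ge0 ?ltW. Qed.

Lemma normr_lt_sqrtD : `|mu| < D.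
Proof.
rewrite -sqrtr_sqr /D ltr_sqrt; first by rewrite ltrDl !mulr_gt0 ?exprn_gt0.
by rewrite ltr_wpDl ?sqr_ge0// !mulr_gt0 ?exprn_gt0.
Qed.

Let D_gt0 : 0 < D. Proof. exact: le_lt_trans normr_lt_sqrtD. Qed.
Let Dp_gt0 : 0 < D + mu.
Proof. by have := normr_lt_sqrtD; rewrite ltr_norml => /andP[h _];
  rewrite -ltrBlDr sub0r ltrNl. Qed.
Let Dm_gt0 : 0 < D - mu.
Proof. by have := normr_lt_sqrtD; rewrite ltr_norml subr_gt0 => /andP[]. Qed.

Lemma integral_laplace_arg (x S : R) : 0 < S ->
  (\int[lebesgue_measure]_(w in `]0%R, +oo[)
     (expR (- w) * Phi (laplace_arg x (w, S)))%:E =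
   (if (x <= 0)%R then (D - mu) / (2 * D) * expR (x * (lambda / (D - mu)) * S)
    else 1 - (D + mu) / (2 * D) * expR (- (x * (lambda / (D + mu)) * S)))%:E)%E.
Proof.
move=> S0.
(* [alpha] and [beta] are the coefficients of [1 / sqrt w] and [sqrt w] in
   [laplace_arg x (w, S)]. *)
pose alpha := rl * x * S / (2 * sigma).
pose beta := - mu / (sigma * rl).
have rl0 : 0 < rl by rewrite sqrtr_gt0.
have rlE : rl ^+ 2 = lambda by rewrite sqr_sqrtr// ltW.
have [rln sn Sn] : [/\ rl != 0, sigma != 0 & S != 0] by split; rewrite gt_eqF.
have [Dn Dpn Dmn] : [/\ D != 0, D + mu != 0 & D - mu != 0] by split;
  rewrite gt_eqF.
have dE : Num.sqrt (beta ^+ 2 + 2) = D / (sigma * rl).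
  rewrite -[RHS]ger0_norm; last by rewrite divr_ge0// ltW// mulr_gt0.
  rewrite -sqrtr_sqr; congr Num.sqrt; rewrite /beta !expr_div_n sqrrN D_sqr.
  by rewrite exprMn -rlE; field; rewrite rln sn.
(* [exponential_mixture] yields rates of the form [(D + mu) / (2 sigma ^ 2)]; this conjugate
   identity turns them into [lambda / (D - mu)], and likewise with the signs exchanged. *)
have lamE : lambda = (D + mu) * (D - mu) / (2 * sigma ^+ 2).
  rewrite (_ : (D + mu) * (D - mu) = D ^+ 2 - mu ^+ 2); last by ring.
  by rewrite D_sqr; field; rewrite sn.
transitivity (\int[lebesgue_measure]_(w in `]0%R, +oo[)
   (expR (- w) * Phi (alpha / Num.sqrt w + beta * Num.sqrt w))%:E)%E.
  apply: eq_integral => w; rewrite inE /= in_itv/= andbT => w0.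
  congr (_ * Phi _)%:E; rewrite /laplace_arg /= (sqrtrM w (ltW lambda_gt0))
    -/rl.
  have rw0 : 0 < Num.sqrt w by rewrite sqrtr_gt0.
  rewrite /alpha /beta -rlE; have := sqr_sqrtr (ltW w0).
  move: (Num.sqrt w) rw0 => r r0 <-; field.
  by rewrite rln sn Sn gt_eqF.
rewrite exponential_mixture dE; congr (_%:E).
have -> : (alpha <= 0) = (x <= 0).
  rewrite /alpha -mulrA -mulrA pmulr_rle0// pmulr_lle0//.
  by rewrite divr_gt0// mulr_gt0.
case: ifP => _; [congr (_ * expR _)|congr (1 - _ * expR (- _))].
- by rewrite /beta; field; rewrite rln sn Dn.
- rewrite /alpha /beta; rewrite [in RHS]lamE; field.
  by rewrite rln sn Dmn.
- by rewrite /beta; field; rewrite rln sn Dn.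
- rewrite /alpha /beta; rewrite [in RHS]lamE; field.
  by rewrite rln sn Dpn.
Qed.

End asymmetric_laplace.

(** With [Y] frozen by independence, the event is that a normal variable lies below a constant;
    strict and weak inequality have the same probability because the normal law has no atoms. *)
Lemma normal_comparison {R : realType} {d d2 : measure_display}
    {T : measurableType d} {T2 : measurableType d2}
    (P : probability T R) (X : {RV P >-> R}) (Y : {mfun T >-> T2}) (h : T2 ->
      R) :
  (forall A : set R, measurable A -> distribution P X A = normal_prob 0 1 A) ->
  independent2 P X Y -> measurable_fun setT h ->
  P [set w | X w < h (Y w)] = (\int[P]_w (Phi (h (Y w)))%:E)%E.
Proof.
move=> hX ind mh.
pose B : set (R * T2) := [set z | z.1 < h z.2].
have mB : measurable B.
  rewrite (_ : B = (fun z => z.1 - h z.2) @^-1` `]-oo, 0[); last first.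
    by apply/seteqP; split => z /=; rewrite in_itv/= subr_lt0.
  rewrite -[X in measurable X]setTI.
  have mf : measurable_fun setT (fun z : R * T2 => z.1 - h z.2).
    apply: measurable_funB; first exact: measurable_fst.
    exact: (measurableT_comp mh measurable_snd).
  exact: mf.
transitivity (\int[P]_w (\1_B (X w, Y w))%:E)%E.
  have mE : measurable [set w | X w < h (Y w)].
    rewrite (_ : [set _ | _] = mfun_pair X Y @^-1` B)//.
    by rewrite -[X in measurable X]setTI; exact: measurable_funP.
  rewrite -[LHS](_ : (\int[P]_w (\1_[set w | X w < h (Y w)] w)%:E = _)%E);
    last first.
    by rewrite integral_indic// setIT.
  by apply: eq_integral => w _; rewrite !indicE; congr (_%:R%:E);
    apply/idP/idP; rewrite !inE.
rewrite (independent2_integral P X Y (fun z => (\1_B z)%:E) ind).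
- apply: eq_integral => w _.
  rewrite (_ : (fun y => _) = (fun y => (\1_(`]-oo, h (Y w)[) y)%:E)).
    rewrite integral_indic// setIT.
    exact: etrans (hX _ (measurable_itv _)) (normal_prob_lt _).
  by apply/funext => y; rewrite !indicE; congr (_%:R%:E); apply/idP/idP;
    rewrite !inE /= in_itv.
- by apply/measurable_EFinP; exact: measurable_indic.
- by move=> z; rewrite lee_fin indicE ler0n.
Qed.

(** With [D] the square root in [a1] and [a2], the normal-exponential mixture has tail rates
    [2 lambda / (D + mu)] and [2 lambda / (D - mu)], which the factor 2 in [V] halves. Hence the
    numerator [lambda]; a numerator 1 gives the law of [Z] only for [lambda = 1]. *)
Theorem theorem3 (R : realType) (gamma mu sigma lambda : R)
    (hgamma0 : 0 < gamma) (hgamma1 : gamma <= 1)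
    (hsigma : 0 < sigma) (hlambda : 0 < lambda)
    (d : measure_display) (T : measurableType d) (P : probability T R)
    (X W1 S : {RV P >-> R})
    (hX : forall A : set R, measurable A -> distribution P X A = normal_prob 0 1 A)
    (hW1 : forall A : set R, measurable A ->
       distribution P W1 A = exponential_prob 1 A)
    (hS : strictly_stable P S gamma 1)
    (hindep : mutually_independent3 P X W1 S)
    (d' : measure_display) (T' : measurableType d') (P' : probability T' R)
    (Z : {RV P' >-> R}) :
  let V := fun w : T => 2 * (S w)^-1 in
  let a1 := lambda / (Num.sqrt (mu ^+ 2 + 2 * lambda * sigma ^+ 2) + mu) in
  let a2 := lambda / (Num.sqrt (mu ^+ 2 + 2 * lambda * sigma ^+ 2) - mu) in
  eq_law P' Z P
    (fun w => (sigma / Num.sqrt lambda * (X w * Num.sqrt (W1 w))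
               + mu * W1 w / lambda) * V w) ->
  (forall x : R,
     P' [set w | Z w < x] =
       'E_P[fun w => Phi ((lambda * x - mu * W1 w * V w)
                          / (sigma * Num.sqrt (lambda * W1 w) * V w))]%E /\
     P' [set w | Z w < x] = (asym_weibull_cdf a1 a2 gamma x)%:E) /\
  (forall (e : measure_display) (U : measurableType e) (Q : probability U R)
     (W : {RV Q >-> R}),
     asym_weibull Q W a1 a2 gamma ->
     eq_law P' Z Q W /\
     (forall x : R, P' [set w | Z w < x] = Q [set w | W w < x])).
Proof.
move=> V a1 a2 hZ.
pose h x := laplace_arg mu sigma lambda x.
have mh x : measurable_fun setT (h x) by exact: measurable_laplace_arg.
have S0 : P [set w | S w <= 0] = 0 by exact: (strictly_stable_le0 P S gamma).
have mV : measurable_fun setT V.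
  by apply: measurable_funM => //; apply: (measurableT_comp measurable_invr).
have mle0 (Y : {RV P >-> R}) : measurable [set w | Y w <= 0].
  rewrite (_ : [set _ | _] = Y @^-1` `]-oo, 0]).
    by rewrite -[X in measurable X]setTI; exact: measurable_funP.
  by apply/seteqP; split => w /=; rewrite in_itv.
(* Outside [N] the inequality can be solved for [X]; on [N] square roots and inverses take
   conventional values or a sign flips, so the two events are compared only up to this null set. *)
pose N := [set w | W1 w <= 0] `|` [set w | S w <= 0].
have mN : measurable N by exact: measurableU.
have PN : P N = 0%E.
  rewrite /N null_set_setU//.
  have := exponential_le0 P W1 hW1.
  by rewrite (_ : _ @^-1` _ = [set w | W1 w <= 0])//; apply/seteqP;
    split => w /=; rewrite in_itv.
pose f := fun w => (sigma / Num.sqrt lambda * (X w * Num.sqrt (W1 w))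
               + mu * W1 w / lambda) * V w.
have mf : measurable_fun setT f.
  apply: measurable_funM => //; apply: measurable_funD.
    apply: measurable_funM => //; apply: measurable_funM => //.
    by apply: (measurableT_comp measurable_sqrtr).
  by apply: measurable_funM => //; exact: measurable_funM.
have step1 x : P' [set w | Z w < x] = (\int[P]_w (Phi (h x (W1 w, S w)))%:E)%E.
  have mA : measurable [set w | f w < x].
    rewrite (_ : [set _ | _] = f @^-1` `]-oo, x[); last first.
      by apply/seteqP; split => w /=; rewrite in_itv.
    by rewrite -[X in measurable X]setTI; exact: mf.
  have mB : measurable [set w | X w < h x (W1 w, S w)].
    rewrite (_ : [set _ | _] = (fun w => X w - h x (mfun_pair W1 S w)) @^-1`
      `]-oo, 0[); last first.
      by apply/seteqP; split => w /=; rewrite in_itv/= subr_lt0.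
    rewrite -[X in measurable X]setTI.
    have mXh : measurable_fun setT (fun w => X w - h x (mfun_pair W1 S w)).
      by apply: measurable_funB => //; apply: (measurableT_comp (mh x)).
    exact: mXh.
  transitivity (P [set w | f w < x]).
    have := hZ `]-oo, x[%classic (measurable_itv _).
    rewrite (_ : Z @^-1` _ = [set w | Z w < x]); last first.
      by apply/seteqP; split => w /=; rewrite in_itv.
    by move=> ->; congr (P _).
  rewrite -(normal_comparison P X (mfun_pair W1 S) (h x) hX
    (mutually_independent3_pair P X W1 S hindep) (mh x)).
  have fX w : 0 < W1 w -> 0 < S w -> (f w < x) = (X w < h x (W1 w, S w)).
    by move=> ? ?; rewrite /f /V laplace_argP.
  apply/eqP; rewrite eq_le; apply/andP; split;
    apply: (@le_measure_null _ _ _ _ _ _ N) => //.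
    move=> w /= fw.
    have [Ww|Ww] := leP (W1 w) 0; first by right; left.
    have [Sw|Sw] := leP (S w) 0; first by right; right.
    by left; rewrite -fX.
  move=> w /= fw.
  have [Ww|Ww] := leP (W1 w) 0; first by right; left.
  have [Sw|Sw] := leP (S w) 0; first by right; right.
  by left; rewrite fX.
have lap (y : R) : 0 < y ->
    (\int[P]_w (expR (- y * S w))%:E = (expR (- (y `^ gamma)))%:E)%E.
  by move=> y0; exact: (strictly_stable_laplace P S gamma).
have ilap (y : R) : 0 < y -> P.-integrable setT (EFin \o (fun w => expR (- y *
  S w))).
  move=> y0; apply/integrableP; split.
    apply/measurable_EFinP; apply: measurableT_comp => //;
      exact: measurable_funM.
  under eq_integral do rewrite /= ger0_norm ?expR_ge0//.
  by rewrite lap// ltry.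
have step2 x : (\int[P]_w (Phi (h x (W1 w, S w)))%:E =
    (asym_weibull_cdf a1 a2 gamma x)%:E)%E.
  have mPhi : measurable_fun setT (fun z : R * R => (Phi (h x z))%:E).
    by apply/measurable_EFinP; exact: (measurableT_comp measurable_Phi (mh x)).
  have Phi0 (z : R * R) : (0 <= (Phi (h x z))%:E)%E by rewrite lee_fin Phi_ge0.
  rewrite (independent2_integral P W1 S (fun z => (Phi (h x z))%:E)
    (mutually_independent3_23 P X W1 S hindep) mPhi Phi0).
  pose D := Num.sqrt (mu ^+ 2 + 2 * lambda * sigma ^+ 2).
  (* The result of integrating out [W1] with [S = s] fixed. Up to constants it is a single
     exponential in [s], so its expectation is read off the Laplace transform. *)
  pose K s := if x <= 0 then (D - mu) / (2 * D) * expR (x * a2 * s)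
    else 1 - (D + mu) / (2 * D) * expR (- (x * a1 * s)).
  transitivity (\int[P]_w (K (S w))%:E)%E.
    apply: ae_eq_integral => //.
    - apply: (measurableT_comp (measurable_fun_fubini_tonelli_G (m1 :=
      distribution P W1)
        _ mPhi Phi0)) => //.
    - apply/measurable_EFinP; rewrite /K; case: (x <= 0).
        by apply: measurable_funM => //; apply: measurableT_comp => //;
          exact: measurable_funM.
      apply: measurable_funB => //; apply: measurable_funM => //.
      apply: measurableT_comp => //; apply: measurableT_comp => //;
        exact: measurable_funM.
    (* The closed form of the inner integral is available for [S > 0] only. *)
    - exists [set w | S w <= 0]; split => //.
      move=> w /=; apply: contra_notP => /negP; rewrite -ltNge => Sw _.
      rewrite integral_exponential//; last 2 first.
      + exact: (measurableT_comp measurable_Phi (measurable_fun_pair1 (S w) (mh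
        x))).
      + by move=> y; rewrite Phi_ge0 Phi_le1.
      by rewrite integral_laplace_arg.
  have := normr_lt_sqrtD mu sigma lambda hsigma hlambda;
    rewrite -/D ltr_norml => /andP[D1 D2].
  have Dp : 0 < D + mu by rewrite -ltrBlDr sub0r ltrNl.
  have Dm : 0 < D - mu by rewrite subr_gt0.
  have D0 : 0 < D by exact: le_lt_trans (normr_ge0 mu) (normr_lt_sqrtD _ _ _
    hsigma hlambda).
  have [Dpn Dmn Dn] : [/\ D + mu != 0, D - mu != 0 & D != 0].
    by split; rewrite gt_eqF.
  have a10 : 0 < a1 by rewrite divr_gt0.
  have a20 : 0 < a2 by rewrite divr_gt0.
  have sn : lambda * (D - mu) + lambda * (D + mu) != 0 by rewrite gt_eqF//
    addr_gt0// mulr_gt0.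
  (* The common factor [lambda] cancels, so the weights of the Laplace tails are those of the
     Weibull law. *)
  have p1 : a1 / (a1 + a2) = (D - mu) / (2 * D).
    by rewrite /a1 /a2 -/D; field; rewrite Dpn Dmn Dn sn.
  have p2 : a2 / (a1 + a2) = (D + mu) / (2 * D).
    by rewrite /a1 /a2 -/D; field; rewrite Dpn Dmn Dn sn.
  have c1 : 0 <= (D - mu) / (2 * D) by rewrite divr_ge0// ltW// mulr_gt0.
  rewrite /K /asym_weibull_cdf p1 p2.
  have [x0|x0|->] := ltgtP x 0.
  - have y0 : 0 < a2 * `|x| by rewrite mulr_gt0// normr_gt0 lt_eqF.
    under eq_integral => w _.
      rewrite (_ : x * a2 = - (a2 * `|x|)); last by rewrite ltr0_norm//; ring.
      rewrite EFinM; over.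
    rewrite integralZl//; last exact: ilap.
    by rewrite lap// EFinM.
  - have y0 : 0 < a1 * x by rewrite mulr_gt0.
    under eq_integral => w _.
      rewrite (_ : - (x * a1 * S w) = - (a1 * x) * S w); last by ring.
      rewrite EFinB EFinM; over.
    rewrite integralB//; last 2 first.
    + exact: finite_measure_integrable_cst.
    + by apply: integrableZl => //; exact: ilap.
    rewrite integral_cst//= probability_setT mule1 integralZl//;
      last exact: ilap.
    by rewrite lap// EFinB EFinM.
  (* At [x = 0] the Laplace transform would be taken at 0, which [lap] excludes; the integrand is
     constant, and [0 ^ gamma = 0] since [gamma] is nonzero. *)
  - under eq_integral do rewrite !mul0r expR0 mulr1.
    by rewrite integral_cst//= probability_setT mule1 normr0 mulr0 powR0
      ?gt_eqF// oppr0 expR0 mulr1.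
have cdfZ x : P' [set w | Z w < x] = (asym_weibull_cdf a1 a2 gamma x)%:E.
  by rewrite step1 step2.
split.
  move=> x; split; last exact: cdfZ.
  by rewrite step1 expectation.unlock.
move=> e U Q W hW.
have eqcdf x : P' [set w | Z w < x] = Q [set w | W w < x] by rewrite cdfZ hW.
by split => //; exact: eq_law_cdf.
Qed.
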